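(* Let $(X,\delta_X)$ and $(Y,\delta_Y)$ be represented spaces with $X\subseteq Y$. Then $$\delta_{X_{\mathsf{J}}}\leq\delta_Y\iff\delta_X\leq\delta_{Y'}.$$
   Context: A representation of a set $X$ is a surjective partial function $\delta_X:\subseteq\mathbb{N}^{\mathbb{N}}\to X$; $(X,\delta_X)$ is then a represented space. For represented spaces $(X,\delta_X)$, $(Y,\delta_Y)$ with $X\subseteq Y$, $\delta_X\leq\delta_Y$ (''$\delta_X$ is reducible to $\delta_Y$'') means that the injection $\mathrm{id}:(X,\delta_X)\to(Y,\delta_Y)$ is computable, i.e. there is a computable $F:\subseteq\mathbb{N}^{\mathbb{N}}\to\mathbb{N}^{\mathbb{N}}$ with $\delta_YF(p)=\delta_X(p)$ for all $p\in\mathrm{dom}(\delta_X)$. A partial function $F:\subseteq\mathbb{N}^{\mathbb{N}}\to\mathbb{N}^{\mathbb{N}}$ is computable if there is a Turing machine (infinite input tape, one-way output tape) that on each $p\in\mathrm{dom}(F)$ produces $F(p)$ in the long run; nothing is required outside $\mathrm{dom}(F)$. With $\langle n,k\rangle:=\frac12(n+k)(n+k+1)+k$ and $\langle p_0,p_1,\dots\rangle\langle n,k\rangle:=p_n(k)$, let $\lim:\subseteq\mathbb{N}^{\mathbb{N}}\to\mathbb{N}^{\mathbb{N}}$, $\langle p_0,p_1,\dots\rangle\mapsto\lim_{i\to\infty}p_i$ (product topology). The Turing jump $\mathsf{J}:\mathbb{N}^{\mathbb{N}}\to\mathbb{N}^{\mathbb{N}}$ is given by $\mathsf{J}(p)(i)=1$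 if the $i$-th Turing machine halts upon input $p$, and $0$ otherwise; it is injective with partial inverse $\mathsf{J}^{-1}$. $\delta_{X_{\mathsf{J}}}:=\delta_X\circ\mathsf{J}^{-1}$ is a representation of $X$ and $\delta_{Y'}:=\delta_Y\circ\lim$ is a representation of $Y$. *)

(* Defs.v *)
From mathcomp Require Import all_boot.
From mathcomp Require Import all_classical topology.

Set Implicit Arguments.
Unset Strict Implicit.
Unset Printing Implicit Defensive.

Local Open Scope classical_set_scope.
Local Open Scope nat_scope.

Definition baire := nat -> nat.

Record pfun (A B : Type) := PFun {
  graph :> A -> B -> Prop;
  graph_functional : forall a b b', graph a b -> graph a b' -> b = b' }.

Definition pcomp_graph A B C (g : pfun B C) (f : pfun A B) (a : A) (c : C) :=
  exists2 b, f a b & g b c.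

Lemma pcomp_functional A B C (g : pfun B C) (f : pfun A B) a c c' :
  pcomp_graph g f a c -> pcomp_graph g f a c' -> c = c'.
Proof.
move=> [b fab gbc] [b' fab' gbc'].
by rewrite (graph_functional fab fab') in gbc; exact: graph_functional gbc gbc'.
Qed.

Definition pcomp A B C (g : pfun B C) (f : pfun A B) : pfun A C :=
  PFun (@pcomp_functional _ _ _ g f).

Lemma pinv_functional A B (f : A -> B) (finj : injective f) b a a' :
  f a = b -> f a' = b -> a = a'.
Proof. by move=> <- /finj. Qed.

Definition pinv A B (f : A -> B) (finj : injective f) : pfun B A :=
  PFun (pinv_functional finj).

Definition cpair (n k : nat) : nat := ((n + k) * (n + k + 1)) %/ 2 + k.

Fixpoint cunpair (m : nat) : nat * nat :=
  if m is m'.+1 then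
    let: (n, k) := cunpair m' in
    if n is n'.+1 then (n', k.+1) else (k.+1, 0)
  else (0, 0).

Lemma cpairSr n k : cpair n k.+1 = (cpair n.+1 k).+1.
Proof. by rewrite /cpair addSnnS addnS. Qed.

Lemma cpairS0 k : cpair k.+1 0 = (cpair 0 k).+1.
Proof.
rewrite /cpair !addn0 !add0n !addn1.
have -> : k.+1 * k.+2 = k.+1 * 2 + k * k.+1.
  by rewrite -[k.+2]add2n mulnDr [k.+1 * k]mulnC.
by rewrite divnMDl // addSn addnC.
Qed.

Lemma cpairK n k : cunpair (cpair n k) = (n, k).
Proof.
have [m] := ubnP (cpair n k); elim: m n k => // m IH n [|k].
  case: n => [|n]; first by [].
  by rewrite cpairS0 ltnS => /IH /= ->.
by rewrite cpairSr ltnS => /IH /= ->.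
Qed.

Lemma cunpairK m : cpair (cunpair m).1 (cunpair m).2 = m.
Proof.
elim: m => //= m; case: (cunpair m) => -[|n] k /= <-.
  by rewrite cpairS0.
by rewrite cpairSr.
Qed.

Lemma leq_cpairr n k : k <= cpair n k.
Proof. exact: leq_addl. Qed.

Definition code_seq (s : seq nat) : nat := foldr (fun a b => (cpair a b).+1) 0 s.

Fixpoint decode_seq_rec (fuel m : nat) : seq nat :=
  if fuel is fuel'.+1 then
    if m is m'.+1 then
      let: (a, b) := cunpair m' in a :: decode_seq_rec fuel' b
    else [::]
  else [::].

Definition decode_seq (m : nat) : seq nat := decode_seq_rec m m.

Lemma code_seqK : cancel code_seq decode_seq.
Proof.
move=> s; suff H f : code_seq s <= f -> decode_seq_rec f (code_seq s) = s.
  exact: H.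
elim: s f => [|a s IH] [|f] //= le_f; rewrite cpairK IH //.
exact: leq_trans (leq_cpairr a _) le_f.
Qed.

(** A Turing machine has one read-only input tape, [mtapes] work tapes and a write-only
    one-way output tape.  All tapes are infinite to the right; a head on the
    leftmost cell that is told to move left stays there.  Tape symbols are
    natural numbers, 0 being the blank; only finitely many of them occur in the
    finite table of a machine. *)

Inductive move := MLeft | MStay | MRight.

(** [rscan] and [rmove] list the input tape first and then the work tapes;
    [rwrite] lists the work tapes only.  Missing entries of [rwrite] and
    [rmove] stand for the blank and for [MStay]. *)
Record rule := Rule {
  rstate : nat;
  rscan : seq nat;
  rnext : nat;
  rwrite : seq nat;
  rmove : seq move;
  rout : option bool }.

Record machine := Machine {
  mtapes : nat;
  mstart : nat;
  mrules : seq rule }.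

(** A work tape is its head position together with a finite prefix of the tape,
    the remaining cells being blank. *)
Record config := Config {
  cstate : nat;
  cinput : nat;
  cwork : seq (nat * seq nat);
  cout : seq bool }.

(** A point [p] of Baire space is written on a tape in unary, as the infinite
    word 1^(p 0) 0 1^(p 1) 0 1^(p 2) 0 and so on. *)
Definition unary (p : baire) (n : nat) : seq bool :=
  flatten [seq rcons (nseq (p i) true) false | i <- iota 0 n].

Definition unary_bit (p : baire) (c : nat) : bool := nth false (unary p c.+1) c.

(** Cell 0 of the input tape is blank and marks its left end; the bits of the
    input word follow, with 0 and 1 represented by the symbols 1 and 2. *)
Definition input_cell (p : baire) (c : nat) : nat :=
  if c is c'.+1 then (unary_bit p c').+1 else 0.

Definition init (M : machine) : config :=
  Config (mstart M) 0 (nseq (mtapes M) (0, [::])) [::].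

Definition scanned (p : baire) (c : config) : seq nat :=
  input_cell p (cinput c) :: [seq nth 0 t.2 t.1 | t <- cwork c].

Definition shift (d : move) (h : nat) : nat :=
  match d with MLeft => h.-1 | MStay => h | MRight => h.+1 end.

Definition apply_rule (r : rule) (c : config) : config :=
  Config (rnext r)
    (shift (nth MStay (rmove r) 0) (cinput c))
    (mkseq (fun j =>
       let: (h, s) := nth (0, [::]) (cwork c) j in
       (shift (nth MStay (rmove r) j.+1) h, set_nth 0 s h (nth 0 (rwrite r) j)))
      (size (cwork c)))
    (if rout r is Some b then rcons (cout c) b else cout c).

(** The first rule that matches the state and the scanned symbols is applied;
    [None] means that the machine has halted. *)
Definition step (M : machine) (p : baire) (c : config) : option config :=
  omap (apply_rule^~ c)
    (ohead [seq r <- mrules M | (rstate r == cstate c) && (rscan r == scanned p c)]).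

Definition run (M : machine) (p : baire) (t : nat) : option config :=
  iter t (obind (step M p)) (Some (init M)).

Definition halts (M : machine) (p : baire) : Prop := exists t, run M p t = None.

(** On input [p], the infinite word written on the output tape is that of [q]. *)
Definition produces (M : machine) (p q : baire) : Prop :=
  forall n, exists t c, run M p t = Some c /\ prefix (unary q n) (cout c).

Definition computable (F : pfun baire baire) : Prop :=
  exists M : machine, forall p q, F p q -> produces M p q.

Definition code_move (d : move) : nat :=
  match d with MLeft => 0 | MStay => 1 | MRight => 2 end.
Definition decode_move (n : nat) : move :=
  match n with 0 => MLeft | 1 => MStay | _ => MRight end.

Definition code_out (o : option bool) : nat :=
  match o with None => 0 | Some false => 1 | Some true => 2 end.
Definition decode_out (n : nat) : option bool :=
  match n with 0 => None | 1 => Some false | _ => Some true end.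

Definition code_rule (r : rule) : nat :=
  cpair (rstate r) (cpair (code_seq (rscan r)) (cpair (rnext r)
    (cpair (code_seq (rwrite r))
      (cpair (code_seq (map code_move (rmove r))) (code_out (rout r)))))).

Definition decode_rule (n : nat) : rule :=
  let: (q, n1) := cunpair n in
  let: (a, n2) := cunpair n1 in
  let: (q', n3) := cunpair n2 in
  let: (w, n4) := cunpair n3 in
  let: (m, o) := cunpair n4 in
  Rule q (decode_seq a) q' (decode_seq w) (map decode_move (decode_seq m))
    (decode_out o).

Definition code_machine (M : machine) : nat :=
  cpair (mtapes M) (cpair (mstart M) (code_seq (map code_rule (mrules M)))).

Definition decode_machine (i : nat) : machine :=
  let: (k, n) := cunpair i in
  let: (q, s) := cunpair n in
  Machine k q (map decode_rule (decode_seq s)).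

Lemma code_ruleK : cancel code_rule decode_rule.
Proof.
case=> q a q' w m o; rewrite /code_rule /decode_rule /= !(cpairK, code_seqK).
have cmK : cancel code_move decode_move by case.
by rewrite (mapK cmK); case: o => [[]|].
Qed.

Lemma code_machineK : cancel code_machine decode_machine.
Proof.
case=> k q s; rewrite /code_machine /decode_machine /= !cpairK code_seqK.
by rewrite (mapK code_ruleK).
Qed.

(** The Turing machine number [i] is [decode_machine i]; by [code_machineK]
    every machine has a number. *)
Definition J (p : baire) : baire := fun i => `[< halts (decode_machine i) p >].

Lemma unaryS p n : unary p n.+1 = unary p n ++ rcons (nseq (p n) true) false.
Proof.
by rewrite /unary -[n.+1]addn1 iotaD map_cat flatten_cat /= cats0 add0n.
Qed.

Lemma size_unary p n : n <= size (unary p n).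
Proof.
elim: n => // n IH; rewrite unaryS size_cat size_rcons size_nseq addnS ltnS.
exact: leq_trans IH (leq_addr _ _).
Qed.

Lemma prefix_unary p m n : m <= n -> prefix (unary p m) (unary p n).
Proof.
move=> /subnK <-; elim: (n - m) => [|d IH]; first exact: prefix_refl.
by rewrite addSn unaryS; exact: prefix_trans IH (prefix_prefix _ _).
Qed.

Lemma unary_bitE p n c : c < size (unary p n) ->
  unary_bit p c = nth false (unary p n) c.
Proof.
move=> ltc; have lt1 : c < size (unary p c.+1) by exact: size_unary.
rewrite /unary_bit; case: (leqP c.+1 n) => [|/ltnW] /(prefix_unary p).
  by move=> /prefixP [s ->]; rewrite [RHS]nth_cat lt1.
by move=> /prefixP [s ->]; rewrite [LHS]nth_cat ltc.
Qed.

Lemma unary_bit_inj p q : unary_bit p =1 unary_bit q -> p = q.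
Proof.
move=> eqpq; suff: forall n, {in gtn n, p =1 q}.
  by move=> H; apply/funext => i; exact: (H i.+1 i (ltnSn i)).
elim=> // n IH i; rewrite inE ltnS leq_eqVlt => /predU1P[-> | /IH //].
have bit (f : baire) j : j <= f n ->
    unary_bit f (size (unary f n) + j) = (j < f n).
  move=> lejf; rewrite (@unary_bitE _ n.+1) unaryS.
    rewrite nth_cat ltnNge leq_addr /= addKn nth_rcons size_nseq.
    by case: ltngtP lejf => // lj _; rewrite nth_nseq lj.
  by rewrite size_cat ltn_add2l size_rcons size_nseq.
have equ : unary p n = unary q n.
  rewrite /unary; congr flatten; apply/eq_in_map => j.
  by rewrite mem_iota add0n => /andP[_ ltjn]; rewrite IH.
apply/eqP; rewrite eqn_leq; apply/andP; split; rewrite leqNgt; apply/negP => lt.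
  have := eqpq (size (unary p n) + q n).
  by rewrite (bit p) ?(ltnW lt) // equ (bit q) // lt ltnn.
have := eqpq (size (unary p n) + p n).
by rewrite (bit p) // equ (bit q) ?(ltnW lt) // lt ltnn.
Qed.

Definition walk_rules (s : nat) : seq rule :=
  [seq Rule s [:: a] s.+1 [::] [:: MRight] None | a <- [:: 0; 1; 2]].

Definition test_machine (c : nat) : machine :=
  Machine 0 0 (Rule c.+1 [:: 1] c.+1 [::] [::] None ::
    flatten [seq walk_rules s | s <- iota 0 c.+1]).

Lemma filter_walk_rules m n q a : a < 3 ->
  [seq r <- flatten [seq walk_rules s | s <- iota m n] |
     (rstate r == q) && (rscan r == [:: a])] =
  if m <= q < m + n then [:: Rule q [:: a] q.+1 [::] [:: MRight] None] else [::].
Proof.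
move=> lta; elim: n m => [|n IH] m /=.
  by rewrite addn0; case: ltngtP.
rewrite IH addSnnS; case: (ltngtP m q) => [||->] //=.
by case: a lta {IH} => [|[|[|]]] //= _; rewrite !addnS ltnS leq_addr.
Qed.

Lemma input_cell_lt3 p c : input_cell p c < 3.
Proof. by case: c => //= c; case: unary_bit. Qed.

Lemma filter_test_machine c q a : a < 3 ->
  [seq r <- mrules (test_machine c) | (rstate r == q) && (rscan r == [:: a])] =
  (if (c.+1 == q) && (1 == a) then [:: Rule c.+1 [:: 1] c.+1 [::] [::] None]
   else [::]) ++
  (if q < c.+1 then [:: Rule q [:: a] q.+1 [::] [:: MRight] None] else [::]).
Proof.
move=> lta; rewrite -(filter_walk_rules 0 c.+1 q lta) /mrules /test_machine.
have filter1 T (P : pred T) x s :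
    [seq y <- x :: s | P y] = (if P x then [:: x] else [::]) ++ [seq y <- s | P y].
  by move=> /=; case: (P x).
by rewrite filter1 [rscan _]/= eqseq_cons andbT.
Qed.

Lemma run_test_machine c p t : t <= c.+1 ->
  run (test_machine c) p t = Some (Config t t [::] [::]).
Proof.
elim: t => // t IH lttc; rewrite /run iterS -/(run _ _ _) IH ?(ltnW lttc) //.
rewrite [LHS]/(step _ _ _) /step filter_test_machine ?input_cell_lt3 //=.
by rewrite (gtn_eqF lttc) lttc.
Qed.

Lemma halts_test_machine c p : halts (test_machine c) p <-> unary_bit p c.
Proof.
have run1 := @run_test_machine c p _ (leqnn c.+1).
have stepE : step (test_machine c) p (Config c.+1 c.+1 [::] [::]) =
    if unary_bit p c then None else Some (Config c.+1 c.+1 [::] [::]).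
  rewrite /step filter_test_machine ?input_cell_lt3 //= eqxx ltnn cats0.
  by case: unary_bit.
split=> [[t]|bit1]; last by exists c.+2; rewrite /run iterS -/(run _ _ _) run1 /= stepE bit1.
apply: contraPT => /negbTE bit0.
suff [u ->] : exists u, run (test_machine c) p t = Some u by [].
have [/(@run_test_machine _ p) ->|/ltnW] := leqP t c.+1; first by eexists.
move=> /subnK <-; exists (Config c.+1 c.+1 [::] [::]).
elim: (t - _) => [|d IH] //.
by rewrite addSn /run iterS -/(run _ _ _) IH /= stepE bit0.
Qed.

Lemma J_inj : injective J.
Proof.
move=> p q eqJ; apply: unary_bit_inj => c.
have := congr1 (fun f : baire => f (code_machine (test_machine c))) eqJ.
rewrite /J code_machineK.
have E f : `[< halts (test_machine c) f >] = unary_bit f c.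
  by apply/asboolP/idP => /halts_test_machine.
by rewrite !E; do 2 case: unary_bit.
Qed.

Definition row (p : baire) (n : nat) : baire := fun k => p (cpair n k).

(** [{ptws nat -> nat}] carries the product of the discrete topologies. *)
Definition lim_graph (p q : baire) : Prop :=
  row p @ \oo --> (q : {ptws nat -> nat}).

Lemma lim_graphP p q :
  lim_graph p q <-> forall k, exists N, forall n, N <= n -> p (cpair n k) = q k.
Proof.
rewrite /lim_graph; split=> [cvp k|H].
  have /pointwise_cvgP /(_ k) cvk : {ptws, row p @ \oo --> q} by [].
  have : nbhs (q k) [set q k] by rewrite nbhs_principalE; exact/principal_filterP.
  by move=> /cvk [N _ HN]; exists N => n /HN.
suff : {ptws, row p @ \oo --> q} by [].
apply/pointwise_cvgP => k A.
rewrite nbhs_principalE => /principal_filterP Aq.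
by have [N HN] := H k; exists N => // n /= /HN; rewrite /row => ->.
Qed.

Lemma lim_functional p q q' : lim_graph p q -> lim_graph p q' -> q = q'.
Proof.
move=> /lim_graphP Hq /lim_graphP Hq'; apply/funext => k.
have [[N HN] [N' HN']] := (Hq k, Hq' k).
by rewrite -(HN (maxn N N')) ?leq_maxl // -(HN' (maxn N N')) ?leq_maxr.
Qed.

Definition lim : pfun baire baire := PFun lim_functional.

Lemma lim_surj q : exists p, lim p q.
Proof.
exists (fun m => q (cunpair m).2); apply/lim_graphP => k.
by exists 0 => n _; rewrite cpairK.
Qed.

Record represented_space (U : Type) := RepresentedSpace {
  carrier : set U;
  rep : pfun baire U;
  rep_carrier : forall p x, rep p x -> carrier x;
  rep_surj : forall x, carrier x -> exists p, rep p x }.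

(** delta_X <= delta_Y, where delta_X and delta_Y represent X and Y. *)
Definition reducible (U : Type) (X Y : represented_space U) : Prop :=
  exists2 F : pfun baire baire, computable F &
    forall p x, rep X p x -> exists2 q, F p q & rep Y q x.

Lemma rep_jump_carrier U (X : represented_space U) q x :
  pcomp (rep X) (pinv J_inj) q x -> carrier X x.
Proof. by move=> [p _ px]; exact: rep_carrier px. Qed.

Lemma rep_jump_surj U (X : represented_space U) x :
  carrier X x -> exists q, pcomp (rep X) (pinv J_inj) q x.
Proof. by move=> xX; have [p px] := rep_surj xX; exists (J p), p. Qed.

(** X_J: the set X represented by delta_X o J^-1. *)
Definition jump_space U (X : represented_space U) : represented_space U :=
  RepresentedSpace (@rep_jump_carrier U X) (@rep_jump_surj U X).

Lemma rep_lim_carrier U (X : represented_space U) p x :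
  pcomp (rep X) lim p x -> carrier X x.
Proof. by move=> [q _ qx]; exact: rep_carrier qx. Qed.

Lemma rep_lim_surj U (X : represented_space U) x :
  carrier X x -> exists p, pcomp (rep X) lim p x.
Proof.
move=> xX; have [q qx] := rep_surj xX.
by have [p pq] := lim_surj q; exists p, q.
Qed.

(** X': the set X represented by delta_X o lim. *)
Definition limit_space U (X : represented_space U) : represented_space U :=
  RepresentedSpace (@rep_lim_carrier U X) (@rep_lim_surj U X).

(* Main.v *)
Require Import Defs.
From mathcomp Require Import all_boot.
From mathcomp Require Import all_classical topology.

(** If [F] reduces the jump of [X] to [Y], approximate [J p] at stage [s] by the machines
    seen to halt on [p] within [s] steps.  The output of [F] on this approximation after
    [s] steps converges to [F (J p)], and it is primitive recursive in [p].

    Conversely let [y] be the output of [G] on [p], and let [q] be the limit of its rows.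
    That [(N, v)] violates [y (n, k) = v] for some [n >= N] is semidecidable in [p], by a
    machine computed from [k], [N] and [v].  So [J p] decides it, and the first pair
    [(N, v)] without violation has [v = q k].

    Both constructions only run a functional that is primitive recursive in the input
    repeatedly in an unbounded loop, and such loops compile to counter programs and
    these to Turing machines. *)

Set Implicit Arguments.
Unset Strict Implicit.
Unset Printing Implicit Defensive.

Local Open Scope nat_scope.

(** * Functionals primitive recursive in an oracle *)

(** An approximation to [J p] may lie outside the domain of [F], where nothing is known about its
    machine. Hence machines are simulated for a given number of steps only, which is total, and
    whatever has been output by then is read off. Convergence rests on the use principle: in [t]
    steps a machine sees at most [t] cells, so an approximation that is right on the first [t]
    entries yields the same run.

    In the converse direction [J p] is queried at an index that varies with [k], [N] and [v]. This
    calls for an s-m-n theorem for the concrete numbering of machines: the parameter is hard-wired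
    as a chain of states, and the rule table is primitive recursive in its length. Guessing the
    modulus [N] along with the value [v] keeps the question at the level of a single jump, since
    only a quantifier over [n] remains. *)

Inductive pr :=
  | PId | PZero | PSucc | PFst | PSnd | POracle
  | PComp of pr & pr | PPair of pr & pr | PIter of pr.

Fixpoint pr_eval (p : baire) (f : pr) (x : nat) : nat :=
  match f with
  | PId => x
  | PZero => 0
  | PSucc => x.+1
  | PFst => (cunpair x).1
  | PSnd => (cunpair x).2
  | POracle => p x
  | PComp f g => pr_eval p f (pr_eval p g x)
  | PPair f g => cpair (pr_eval p f x) (pr_eval p g x)
  | PIter f => iter (cunpair x).2 (pr_eval p f) (cunpair x).1
  end.

(** * Primitive recursion on coded data *)

Structure coded := Coded { csort :> Type; code : csort -> nat }.
Arguments code {c} _.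

Canonical nat_coded := @Coded nat id.
Canonical bool_coded := @Coded bool nat_of_bool.
Canonical prod_coded (A B : coded) :=
  @Coded (A * B)%type (fun x => cpair (code x.1) (code x.2)).
Canonical seq_coded (A : coded) := @Coded (seq A) (fun s => code_seq (map code s)).
Canonical option_coded (A : coded) :=
  @Coded (option A) (fun o => if o is Some a then (code a).+1 else 0).

(** One program serves all oracles, and only its values at codes count, so types whose codes do not
    exhaust [nat], such as [bool], cause no trouble. *)
Definition prf (A B : coded) (f : baire -> A -> B) :=
  exists c, forall p x, pr_eval p c (code x) = code (f p x).

Implicit Types G A B : coded.

Lemma prf_var G : @prf G G (fun _ x => x).
Proof. by exists PId. Qed.

Lemma prf_const G A (a : A) : @prf G A (fun _ _ => a).
Proof.
by exists (iter (code a) (PComp PSucc) PZero) => p x; elim: (code a) => //= n ->.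
Qed.

Lemma prf_comp G A B (F : baire -> A -> B) (f : baire -> G -> A) :
  prf F -> prf f -> prf (fun p x => F p (f p x)).
Proof. by move=> [c Hc] [d Hd]; exists (PComp c d) => p x /=; rewrite Hd Hc. Qed.

Lemma prf_pair G A B (f : baire -> G -> A) (g : baire -> G -> B) :
  prf f -> prf g -> prf (fun p x => (f p x, g p x)).
Proof. by move=> [c Hc] [d Hd]; exists (PPair c d) => p x /=; rewrite Hd Hc. Qed.

Lemma prf_fst G A B (f : baire -> G -> A * B) :
  prf f -> prf (fun p x => (f p x).1).
Proof. by move=> [c Hc]; exists (PComp PFst c) => p x /=; rewrite Hc /= cpairK. Qed.

Lemma prf_snd G A B (f : baire -> G -> A * B) :
  prf f -> prf (fun p x => (f p x).2).
Proof. by move=> [c Hc]; exists (PComp PSnd c) => p x /=; rewrite Hc /= cpairK. Qed.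

Lemma prf_code G A (f : baire -> G -> A) :
  prf f -> @prf G nat_coded (fun p x => code (f p x)).
Proof. by []. Qed.

Lemma prf_succ G (f : baire -> G -> nat) : prf f -> prf (fun p x => (f p x).+1).
Proof. by move=> [c Hc]; exists (PComp PSucc c) => p x /=; rewrite Hc. Qed.

Lemma prf_oracle G (f : baire -> G -> nat) : prf f -> prf (fun p x => p (f p x)).
Proof. by move=> [c Hc]; exists (PComp POracle c) => p x /=; rewrite Hc. Qed.

Lemma prf_cpair G (f g : baire -> G -> nat) :
  prf f -> prf g -> prf (fun p x => cpair (f p x) (g p x)).
Proof. exact: (@prf_pair G nat_coded nat_coded). Qed.

(** A number already is the code of the pair that it decodes to, so the program for [f] itself
    serves. *)
Lemma prf_cunpair G (f : baire -> G -> nat) :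
  prf f -> prf (fun p x => cunpair (f p x)).
Proof.
move=> [c Hc]; exists c => p x; rewrite Hc [RHS]/code /=.
by rewrite cunpairK.
Qed.

(** [PIter] iterates a function of the accumulator alone, so the context [x] travels along in a pair
    with it. *)
Lemma prf_iter G A (n : baire -> G -> nat) (z : baire -> G -> A)
    (h : baire -> G -> A -> A) :
  prf n -> prf z -> prf (fun p (y : G * A) => h p y.1 y.2) ->
  prf (fun p x => iter (n p x) (h p x) (z p x)).
Proof.
move=> [cn Hn] [cz Hz] [ch Hh].
exists (PComp PSnd (PComp (PIter (PPair PFst ch)) (PPair (PPair PId cz) cn))) => p x /=.
rewrite Hn Hz cpairK /=.
suff -> : forall m, iter m (fun y => cpair (cunpair y).1 (pr_eval p ch y))
    (cpair (code x) (code (z p x))) =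
    cpair (code x) (code (iter m (h p x) (z p x))) by rewrite cpairK.
by elim=> //= m ->; rewrite cpairK; congr cpair; exact: (Hh p (x, _)).
Qed.

Lemma prf_ext G A (f g : baire -> G -> A) :
  prf f -> (forall p x, f p x = g p x) -> prf g.
Proof. by move=> [c Hc] e; exists c => p x; rewrite Hc e. Qed.

(** A boolean, read as 0 or 1, says how often to replace the value of [g] by that of [f]. *)
Lemma prf_if G A (b : baire -> G -> bool) (f g : baire -> G -> A) :
  prf b -> prf f -> prf g -> prf (fun p x => if b p x then f p x else g p x).
Proof.
move=> Hb Hf Hg.
apply: (@prf_ext G A (fun p x => iter (b p x) (fun _ => f p x) (g p x))) => [|p x].
  apply: prf_iter => //.
  by have [c Hc] := Hf; exists (PComp c PFst) => p x /=; rewrite cpairK Hc.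
by case: (b p x).
Qed.

(** Kleene's pairs: iterating [(a, b) -> (b, b + 1)] from [(0, 0)] leaves the predecessor in the
    first component. *)
Lemma prf_pred G (f : baire -> G -> nat) : prf f -> prf (fun p x => (f p x).-1).
Proof.
move=> Hf; apply: prf_ext (_ : prf (fun p x =>
  (iter (f p x) (fun s => (s.2, s.2.+1)) (0, 0)).1)) _ => [|p x].
  apply/prf_fst/prf_iter => //; first exact: prf_const.
  apply: prf_pair; first exact/prf_snd/prf_snd/prf_var.
  exact/prf_succ/prf_snd/prf_snd/prf_var.
by case: (f p x) => //= n; elim: n => //= n ->.
Qed.

Lemma prf_eq0 G (f : baire -> G -> nat) : prf f -> prf (fun p x => f p x == 0).
Proof.
move=> Hf; apply: prf_ext (_ : prf (fun p x => iter (f p x) (fun=> false) true)) _.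
  by apply: prf_iter => //; exact: prf_const.
by move=> p x; case: (f p x).
Qed.

(** Both branches are evaluated on the code level, so [f] may read off fields that are
    junk when [b] fails. *)
Lemma prf_if_code G A (b : baire -> G -> bool) (f g : baire -> G -> A) :
  prf b ->
  (exists c, forall p x, b p x -> pr_eval p c (code x) = code (f p x)) ->
  prf g -> prf (fun p x => if b p x then f p x else g p x).
Proof.
move=> Hb [c Hc] Hg.
have [d Hd] : prf (fun p x => if b p x then pr_eval p c (code x) else code (g p x)).
  by apply: prf_if => //; exists c.
by exists d => p x; rewrite Hd; case: ifP => // /Hc.
Qed.

(** The code of [a :: t] is the successor of the code of [(a, t)], so the predecessor gives both
    parts at once. On the empty list it is junk, hence [prf_if_code]. *)
Lemma prf_seqcase G A B (s : baire -> G -> seq A) (f : baire -> G -> A -> seq A -> B)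
    (g : baire -> G -> B) :
  prf s -> prf (fun p (y : G * (A * seq A)) => f p y.1 y.2.1 y.2.2) -> prf g ->
  prf (fun p x => if s p x is a :: t then f p x a t else g p x).
Proof.
move=> Hs [c Hc] Hg.
apply: prf_ext (_ : prf (fun p x => if code (s p x) != 0 then
    if s p x is a :: t then f p x a t else g p x else g p x)) _ => [|p x]; last first.
  by case: (s p x).
apply: prf_if_code => //.
  apply: prf_ext (_ : prf (fun p x => if code (s p x) == 0 then false else true)) _.
    by apply: prf_if; [exact: prf_eq0 | exact: prf_const..].
  by move=> p x; case: eqP.
have [e He] := prf_pred (prf_code Hs).
exists (PComp c (PPair PId e)) => p x /=; rewrite He.
case: (s p x) => //= a t _.
exact: (Hc p (x, (a, t))).
Qed.

Lemma prf_cons G A (f : baire -> G -> A) (g : baire -> G -> seq A) :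
  prf f -> prf g -> prf (fun p x => f p x :: g p x).
Proof.
move=> [c Hc] [d Hd]; exists (PComp PSucc (PPair c d)) => p x /=.
by rewrite Hc Hd.
Qed.

Lemma prf_some G A (f : baire -> G -> A) :
  prf f -> prf (fun p x => Some (f p x)).
Proof. by move=> [c Hc]; exists (PComp PSucc c) => p x /=; rewrite Hc. Qed.

Lemma prf_optcase G A B (o : baire -> G -> option A)
    (f : baire -> G -> A -> B) (g : baire -> G -> B) :
  prf o -> prf (fun p (y : G * A) => f p y.1 y.2) -> prf g ->
  prf (fun p x => if o p x is Some a then f p x a else g p x).
Proof.
move=> Ho [c Hc] Hg.
apply: prf_ext (_ : prf (fun p x => if code (o p x) != 0 then
    if o p x is Some a then f p x a else g p x else g p x)) _ => [|p x]; last first.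
  by case: (o p x).
apply: prf_if_code => //.
  apply: prf_ext (_ : prf (fun p x => if code (o p x) == 0 then false else true)) _.
    by apply: prf_if; [exact/prf_eq0/prf_code | exact: prf_const..].
  by move=> p x; case: eqP.
have [e He] := prf_pred (prf_code Ho).
exists (PComp c (PPair PId e)) => p x /=; rewrite He.
by case: (o p x) => //= a _; exact: (Hc p (x, a)).
Qed.

Ltac prf_with more := repeat first
  [ assumption
  | lazymatch goal with
    | |- prf (fun _ _ => ?c) => apply: prf_const
    | |- prf (fun _ x => x) => apply: prf_var
    | |- prf (fun p x => (@?f p x).1) => apply: prf_fst
    | |- prf (fun p x => (@?f p x).2) => apply: prf_snd
    | |- prf (fun p x => (@?f p x, @?g p x)) => apply: prf_pair
    | |- prf (fun p x => (@?f p x) :: (@?g p x)) => apply: prf_cons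
    | |- prf (fun p x => Some (@?f p x)) => apply: prf_some
    | |- prf (fun p x => iter (@?n p x) (@?f p x) (@?z p x)) => apply: prf_iter
    | |- prf (fun p x => (@?f p x).+1) => apply: prf_succ
    | |- prf (fun p x => (@?f p x).-1) => apply: prf_pred
    | |- prf (fun p x => p (@?f p x)) => apply: prf_oracle
    | |- prf (fun p x => cpair (@?f p x) (@?g p x)) => apply: prf_cpair
    | |- prf (fun p x => cunpair (@?f p x)) => apply: prf_cunpair
    | H : prf ?F |- prf (fun p x => ?F p (@?f p x)) => apply: (prf_comp (F := F))
    | |- _ => first [more | apply: prf_if | apply: prf_optcase | apply: prf_seqcase | apply: prf_eq0]
    end ].

Lemma prf_add G (f g : baire -> G -> nat) : prf f -> prf g -> prf (fun p x => f p x + g p x).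
Proof.
move=> Hf Hg; apply: prf_ext (_ : prf (fun p x => iter (f p x) succn (g p x))) _.
  by prf_with fail.
by move=> p x; rewrite iter_succn addnC.
Qed.

Lemma prf_sub G (f g : baire -> G -> nat) : prf f -> prf g -> prf (fun p x => f p x - g p x).
Proof.
move=> Hf Hg; apply: prf_ext (_ : prf (fun p x => iter (g p x) predn (f p x))) _.
  by prf_with fail.
by move=> p x; rewrite iter_predn.
Qed.

Lemma prf_leq G (f g : baire -> G -> nat) : prf f -> prf g -> prf (fun p x => f p x <= g p x).
Proof. by move=> Hf Hg; apply: prf_eq0; exact: prf_sub. Qed.

Lemma prf_eqn G (f g : baire -> G -> nat) : prf f -> prf g -> prf (fun p x => f p x == g p x).
Proof.
move=> Hf Hg; apply: prf_ext (_ : prf (fun p x =>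
    (f p x - g p x) + (g p x - f p x) == 0)) _ => [|p x].
  by apply/prf_eq0/prf_add; exact: prf_sub.
by rewrite addn_eq0 !subn_eq0 -eqn_leq.
Qed.

Lemma prf_eq_seq G (f g : baire -> G -> seq nat) :
  prf f -> prf g -> prf (fun p x => f p x == g p x).
Proof.
move=> Hf Hg; apply: prf_ext (prf_eqn (prf_code Hf) (prf_code Hg)) _ => p x.
by rewrite /code /= !map_id (can_eq code_seqK).
Qed.

Lemma prf_and G (f g : baire -> G -> bool) :
  prf f -> prf g -> prf (fun p x => f p x && g p x).
Proof. by move=> Hf Hg; apply: prf_if => //; exact: prf_const. Qed.

Lemma prf_not G (f : baire -> G -> bool) : prf f -> prf (fun p x => ~~ f p x).
Proof.
move=> Hf; apply: prf_ext (_ : prf (fun p x => if f p x then false else true)) _.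
  by prf_with fail.
by move=> p x; case: (f p x).
Qed.

Lemma size_code_seq s : size s <= code_seq s.
Proof. by elim: s => //= a s IH; rewrite ltnS (leq_trans IH) // leq_cpairr. Qed.

(** The code of a list bounds its length and can serve as the number of rounds; the rounds left over
    find an empty list and change nothing. *)
Lemma prf_foldl G A B (f : baire -> G -> B -> A -> B) (z : baire -> G -> B)
    (s : baire -> G -> seq A) :
  prf (fun p (y : G * (B * A)) => f p y.1 y.2.1 y.2.2) -> prf z -> prf s ->
  prf (fun p x => foldl (f p x) (z p x) (s p x)).
Proof.
move=> Hf Hz Hs; pose h p x (st : B * seq A) :=
  if st.2 is a :: t then (f p x st.1 a, t) else st.
apply: prf_ext (_ : prf (fun p x =>
    (iter (code (s p x)) (h p x) (z p x, s p x)).1)) _ => [|p x].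
  apply/prf_fst/prf_iter => //; first exact: prf_pair.
  apply: prf_seqcase; [by prf_with fail | | by prf_with fail].
  apply: prf_pair; last by prf_with fail.
  apply: (prf_comp (F := fun p (y : G * (B * A)) => f p y.1 y.2.1 y.2.2)
    (f := fun p x => (x.1.1, (x.1.2.1, x.2.1)))) => //.
  by prf_with fail.
have : size (s p x) <= code (s p x) by rewrite -(size_map code) size_code_seq.
move: (code _) => n.
elim: n (s p x) (z p x) => [|n IH] [|a t] b // le_t; rewrite iterSr //=.
  by rewrite IH.
exact: IH.
Qed.

Lemma prf_rev G A (s : baire -> G -> seq A) : prf s -> prf (fun p x => rev (s p x)).
Proof.
move=> Hs; apply: prf_ext (_ : prf (fun p x =>
    foldl (fun t a => a :: t) [::] (s p x))) _ => [|p x].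
  by apply: prf_foldl; prf_with fail.
rewrite /rev; elim: (s p x) [::] => //= a t IH u; exact: IH.
Qed.

Lemma prf_foldr G A B (f : baire -> G -> A -> B -> B) (z : baire -> G -> B)
    (s : baire -> G -> seq A) :
  prf (fun p (y : G * (A * B)) => f p y.1 y.2.1 y.2.2) -> prf z -> prf s ->
  prf (fun p x => foldr (f p x) (z p x) (s p x)).
Proof.
move=> Hf Hz Hs; apply: prf_ext (_ : prf (fun p x =>
    foldl (fun b a => f p x a b) (z p x) (rev (s p x)))) _ => [|p x].
  apply: prf_foldl => //; last exact: prf_rev.
  apply: (prf_comp (F := fun p (y : G * (A * B)) => f p y.1 y.2.1 y.2.2)
    (f := fun p x => (x.1, (x.2.2, x.2.1)))) => //.
  by prf_with fail.
by rewrite foldl_rev.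
Qed.

Lemma prf_comp2 G A B (H : coded) (f : baire -> G -> A -> B) (g : baire -> H -> G)
    (h : baire -> H -> A) :
  prf (fun p (y : G * A) => f p y.1 y.2) -> prf g -> prf h ->
  prf (fun p x => f p (g p x) (h p x)).
Proof.
move=> Hf Hg Hh; exact: (prf_comp (F := fun p (y : G * A) => f p y.1 y.2)
    (f := fun p x => (g p x, h p x)) Hf (prf_pair Hg Hh)).
Qed.

Lemma prf_map G A B (f : baire -> G -> A -> B) (s : baire -> G -> seq A) :
  prf (fun p (y : G * A) => f p y.1 y.2) -> prf s ->
  prf (fun p x => map (f p x) (s p x)).
Proof.
move=> Hf Hs; apply: prf_ext (_ : prf (fun p x =>
    foldr (fun a t => f p x a :: t) [::] (s p x))) _ => [|p x].
  apply: prf_foldr => //; last exact: prf_const.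
  by apply: prf_cons; [apply: prf_comp2 => // |]; prf_with fail.
by elim: (s p x) => //= a t ->.
Qed.

Lemma prf_filter G A (f : baire -> G -> A -> bool) (s : baire -> G -> seq A) :
  prf (fun p (y : G * A) => f p y.1 y.2) -> prf s ->
  prf (fun p x => seq.filter (f p x) (s p x)).
Proof.
move=> Hf Hs; apply: prf_ext (_ : prf (fun p x =>
    foldr (fun a t => if f p x a then a :: t else t) [::] (s p x))) _ => [|p x].
  apply: prf_foldr => //; last exact: prf_const.
  by apply: prf_if; [apply: prf_comp2 => // | |]; prf_with fail.
by elim: (s p x) => //= a t ->.
Qed.

Lemma prf_cat G A (s t : baire -> G -> seq A) :
  prf s -> prf t -> prf (fun p x => s p x ++ t p x).
Proof.
move=> Hs Ht; apply: prf_ext (_ : prf (fun p x =>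
    foldr (fun a t => a :: t) (t p x) (s p x))) _ => [|p x].
  by apply: prf_foldr => //; prf_with fail.
by elim: (s p x) => //= a u ->.
Qed.

Lemma prf_size G A (s : baire -> G -> seq A) : prf s -> prf (fun p x => size (s p x)).
Proof.
move=> Hs; apply: prf_ext (_ : prf (fun p x =>
    foldr (fun _ => succn) 0 (s p x))) _ => [|p x].
  by apply: prf_foldr => //; prf_with fail.
by elim: (s p x) => //= a u ->.
Qed.

Lemma prf_behead G A (s : baire -> G -> seq A) :
  prf s -> prf (fun p x => behead (s p x)).
Proof.
move=> Hs; apply: prf_ext (_ : prf (fun p x => if s p x is a :: t then t else [::])) _.
  by prf_with fail.
by move=> p x; case: (s p x).
Qed.

Lemma prf_drop G A (n : baire -> G -> nat) (s : baire -> G -> seq A) :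
  prf n -> prf s -> prf (fun p x => drop (n p x) (s p x)).
Proof.
move=> Hn Hs; apply: prf_ext (_ : prf (fun p x => iter (n p x) behead (s p x))) _.
  by prf_with ltac:(apply: prf_behead).
move=> p x; elim: (n p x) (s p x) => [|m IH] t; first by rewrite drop0.
by rewrite iterSr IH; case: t.
Qed.

Lemma prf_nseq G A (n : baire -> G -> nat) (a : baire -> G -> A) :
  prf n -> prf a -> prf (fun p x => nseq (n p x) (a p x)).
Proof.
move=> Hn Ha; apply: prf_ext (_ : prf (fun p x => iter (n p x) (cons (a p x)) [::])) _ => //.
by prf_with fail.
Qed.

Lemma prf_iota G (m n : baire -> G -> nat) :
  prf m -> prf n -> prf (fun p x => iota (m p x) (n p x)).
Proof.
move=> Hm Hn; apply: prf_ext (_ : prf (fun p x =>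
    rev (iter (n p x) (fun s => (m p x + size s) :: s) [::]))) _ => [|p x].
  apply/prf_rev/prf_iter; [by []|exact: prf_const|].
  apply: prf_cons; last by prf_with fail.
  apply: prf_add; last by apply: prf_size; prf_with fail.
  by apply: (prf_comp (F := m)) => //; prf_with fail.
set h := fun s => _.
have sz n' : size (iter n' h [::]) = n' by elim: n' => //= n' ->.
elim: (n p x) => // n' IH.
by rewrite -[in RHS]addn1 iotaD /= cats1 -IH -rev_cons /h sz.
Qed.

Lemma prf_nth G A (a : baire -> G -> A) (s : baire -> G -> seq A) (n : baire -> G -> nat) :
  prf a -> prf s -> prf n -> prf (fun p x => nth (a p x) (s p x) (n p x)).
Proof.
move=> Ha Hs Hn; apply: prf_ext (_ : prf (fun p x =>
    if drop (n p x) (s p x) is b :: _ then b else a p x)) _ => [|p x].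
  by apply: prf_seqcase; [exact: prf_drop | prf_with fail..].
by rewrite -[in RHS](addn0 (n p x)) -nth_drop; case: drop.
Qed.

Lemma prf_mkseq G A (f : baire -> G -> nat -> A) (n : baire -> G -> nat) :
  prf (fun p (y : G * nat) => f p y.1 y.2) -> prf n ->
  prf (fun p x => mkseq (f p x) (n p x)).
Proof. by move=> Hf Hn; apply: prf_map => //; apply: prf_iota => //; exact: prf_const. Qed.

Lemma prf_set_nth G A (a : baire -> G -> A) (s : baire -> G -> seq A)
    (n : baire -> G -> nat) (b : baire -> G -> A) :
  prf a -> prf s -> prf n -> prf b ->
  prf (fun p x => set_nth (a p x) (s p x) (n p x) (b p x)).
Proof.
(* The truncated difference makes the length the maximum of [n + 1] and the old size, as [set_nth]
   pads. *)
move=> Ha Hs Hn Hb; apply: prf_ext (_ : prf (fun p x =>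
    mkseq (fun i => if i == n p x then b p x else nth (a p x) (s p x) i)
      ((n p x).+1 + (size (s p x) - (n p x).+1)))) _ => [|p x].
  apply: prf_mkseq.
    apply: prf_if.
    - by apply: prf_eqn; [prf_with fail | apply: (prf_comp (F := n)); prf_with fail].
    - by apply: (prf_comp (F := b)); prf_with fail.
    apply: prf_nth; [apply: (prf_comp (F := a)) | apply: (prf_comp (F := s)) |];
      by prf_with fail.
  have Hz := prf_size Hs.
  by apply: prf_add; [|apply: prf_sub]; prf_with fail.
rewrite -maxnE; apply: (@eq_from_nth _ (a p x)); rewrite size_mkseq.
  by rewrite size_set_nth.
by move=> i lti; rewrite nth_mkseq // nth_set_nth /=.
Qed.

Ltac prf_more := idtac; lazymatch goal with
  | |- prf (fun p x => @?f p x + @?g p x) => apply: prf_add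
  | |- prf (fun p x => @?f p x - @?g p x) => apply: prf_sub
  | |- prf (fun p x => @?f p x <= @?g p x) => apply: prf_leq
  | |- prf (fun p x => @eq_op _ (@?f p x) (@?g p x)) => first [apply: prf_eqn | apply: prf_eq_seq]
  | |- prf (fun p x => @?f p x && @?g p x) => apply: prf_and
  | |- prf (fun p x => ~~ @?f p x) => apply: prf_not
  | |- prf (fun p x => foldl (@?f p x) (@?z p x) (@?s p x)) => apply: prf_foldl
  | |- prf (fun p x => foldr (@?f p x) (@?z p x) (@?s p x)) => apply: prf_foldr
  | |- prf (fun p x => map (@?f p x) (@?s p x)) => apply: prf_map
  | |- prf (fun p x => seq.filter (@?f p x) (@?s p x)) => apply: prf_filter
  | |- prf (fun p x => mkseq (@?f p x) (@?s p x)) => apply: prf_mkseq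
  | |- prf (fun p x => iota (@?f p x) (@?s p x)) => apply: prf_iota
  | |- prf (fun p x => nseq (@?f p x) (@?s p x)) => apply: prf_nseq
  | |- prf (fun p x => (@?f p x) ++ (@?s p x)) => apply: prf_cat
  | |- prf (fun p x => drop (@?f p x) (@?s p x)) => apply: prf_drop
  | |- prf (fun p x => rev (@?s p x)) => apply: prf_rev
  | |- prf (fun p x => size (@?s p x)) => apply: prf_size
  | |- prf (fun p x => behead (@?s p x)) => apply: prf_behead
  | |- prf (fun p x => nth (@?a p x) (@?s p x) (@?n p x)) => apply: prf_nth
  | |- prf (fun p x => set_nth (@?a p x) (@?s p x) (@?n p x) (@?b p x)) =>
      apply: prf_set_nth
  end.

Ltac prf := prf_with prf_more.

(** * Counter programs and their compilation to Turing machines *)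

Record state := State { regs : nat -> nat; ihead : nat; outp : seq bool }.

Inductive test :=
  TZero of nat | TInput of pred nat | TNot of test | TAnd of test & test.

Fixpoint holds (p : baire) (t : test) (s : state) : bool :=
  match t with
  | TZero j => regs s j == 0
  | TInput P => P (input_cell p (ihead s))
  | TNot t' => ~~ holds p t' s
  | TAnd t1 t2 => holds p t1 s && holds p t2 s
  end.

(** Slot 0 is the input head; slot [j.+1] is register [j], which a machine
    stores as a head position. *)
Inductive cmd :=
  | Act of nat & move & option bool
  | Seq of cmd & cmd
  | While of test & cmd.

Definition act (k : nat) (d : move) (o : option bool) (s : state) : state :=
  State (fun i => if k == i.+1 then shift d (regs s i) else regs s i)
    (if k == 0 then shift d (ihead s) else ihead s)
    (if o is Some b then rcons (outp s) b else outp s).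

(** Big-step semantics covers terminating executions only; the one loop that may run forever is
    treated at the level of machine runs. *)
Inductive exec (p : baire) : cmd -> state -> state -> Prop :=
  | exec_act k d o s : exec p (Act k d o) s (act k d o s)
  | exec_seq c1 c2 s s1 s2 :
      exec p c1 s s1 -> exec p c2 s1 s2 -> exec p (Seq c1 c2) s s2
  | exec_loop t c s s1 s2 :
      holds p t s -> exec p c s s1 -> exec p (While t c) s1 s2 ->
      exec p (While t c) s s2
  | exec_exit t c s : ~~ holds p t s -> exec p (While t c) s s.

Fixpoint test_bound (t : test) : nat :=
  match t with
  | TZero j => j.+1
  | TInput _ => 0
  | TNot t' => test_bound t'
  | TAnd t1 t2 => maxn (test_bound t1) (test_bound t2)
  end.

Fixpoint cmd_bound (c : cmd) : nat :=
  match c with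
  | Act k _ _ => k
  | Seq c1 c2 => maxn (cmd_bound c1) (cmd_bound c2)
  | While t c' => maxn (test_bound t) (cmd_bound c')
  end.

(** [inext] is an arbitrary function of the scanned symbols. The rule table lists it pointwise,
    which is finite because an input cell carries one of three symbols and a work cell one of
    two. *)
Record instr := Instr {
  inext : seq nat -> nat;
  islot : nat;
  imove : move;
  iout : option bool }.

Definition jump (f : seq nat -> nat) := Instr f 0 MStay None.

Definition nojump := jump (fun=> 0).

(** Entry 0 belongs to the input tape. The symbol 1 is the mark on cell 0 of a work tape, so reading
    it means that the register is zero. *)
Fixpoint test_scan (t : test) (a : seq nat) : bool :=
  match t with
  | TZero j => nth 0 a j.+1 == 1
  | TInput P => P (nth 0 a 0)
  | TNot t' => ~~ test_scan t' a
  | TAnd t1 t2 => test_scan t1 a && test_scan t2 a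
  end.

Fixpoint csize (c : cmd) : nat :=
  match c with
  | Act _ _ _ => 1
  | Seq c1 c2 => csize c1 + csize c2
  | While _ c' => (csize c').+2
  end.

(** A loop occupies two labels besides its body: the test at [q] and, behind the body, the jump
    back. *)
Fixpoint compile (c : cmd) (q : nat) : seq instr :=
  match c with
  | Act k d o => [:: Instr (fun=> q.+1) k d o]
  | Seq c1 c2 => compile c1 q ++ compile c2 (q + csize c1)
  | While t c' =>
      jump (fun a => if test_scan t a then q.+1 else q + (csize c').+2) ::
      rcons (compile c' q.+1) (jump (fun=> q))
  end.

Lemma size_compile c q : size (compile c q) = csize c.
Proof.
elim: c q => //= [c1 IH1 c2 IH2|t c IH] q.
  by rewrite size_cat IH1 IH2.
by rewrite size_rcons IH.
Qed.

Fixpoint bit_words (K : nat) : seq (seq nat) :=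
  if K is K'.+1 then [seq b :: s | b <- [:: 0; 1], s <- bit_words K'] else [:: [::]].

Definition all_scans (K : nat) : seq (seq nat) :=
  [seq a :: s | a <- iota 0 3, s <- bit_words K].

Lemma mem_bit_words s : all (gtn 2) s -> s \in bit_words (size s).
Proof.
elim: s => // b s IH /andP[ltb /IH ins].
by apply/allpairsP; exists (b, s); split=> //; case: b ltb => [|[]].
Qed.

Lemma mem_all_scans a s : a < 3 -> all (gtn 2) s -> a :: s \in all_scans (size s).
Proof.
move=> lta /mem_bit_words ins; apply/allpairsP; exists (a, s); split=> //.
by rewrite mem_iota.
Qed.

Definition reach (M : machine) (p : baire) (n : nat) (c c' : config) : Prop :=
  iter n (obind (step M p)) (Some c) = Some c'.

Lemma reach_trans M p m n c1 c2 c3 :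
  reach M p m c1 c2 -> reach M p n c2 c3 -> reach M p (n + m) c1 c3.
Proof. by rewrite /reach iterD => ->. Qed.

(** A key determines its rule, so all rules that match are the one of the current key, and order or
    repetitions in the table do not matter. *)
Lemma step_table (M : machine) (mk : nat * seq nat -> rule) (keys : seq (nat * seq nat))
    p c :
  mrules M = map mk keys -> (forall k, rstate (mk k) = k.1) ->
  (forall k, rscan (mk k) = k.2) ->
  step M p c = if (cstate c, scanned p c) \in keys
               then Some (apply_rule (mk (cstate c, scanned p c)) c) else None.
Proof.
rewrite /step => -> Hst Hsc; rewrite filter_map.
set k := (_, _); rewrite (@eq_filter _ _ (pred1 k)); last first.
  by case=> q a /=; rewrite Hst Hsc /k xpair_eqE.
elim: keys => //= k' keys IH; rewrite inE [k == _]eq_sym.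
by case: eqP => //= ->.
Qed.

(** * The Turing machine of a counter program *)

Section Machine.
(** The machine has [K.+1] work tapes.  Register [j] is the head position of
    work tape [j], on which cell 0 alone carries the symbol 1.  From state 0
    the machine marks these cells, then counts [w] down through its states while
    moving the head of work tape 0 right, and reaches state 1 with
    [w.+1] in register 0. *)
Variables (K w : nat) (prog : seq instr).

Let L := (size prog).+1.

(** What is read throughout the countdown: the input head is on the left marker, head 0 already past
    its mark, all others on theirs. The move in [start_rule] sees to this, which is why register 0
    ends at [w.+1] and not at [w]. *)
Definition chain_scan : seq nat := 0 :: 0 :: nseq K 1.

Definition chain_rule (s : nat) : rule :=
  Rule (L.+1 + s) chain_scan (if s is s'.+1 then L.+1 + s' else 1) (0 :: nseq K 1)
    (if s is 0 then [::] else [:: MStay; MRight]) None.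

Definition start_rule : rule :=
  Rule 0 (nseq K.+2 0) (L.+1 + w) (nseq K.+1 1) [:: MStay; MRight] None.

(** Writing back [behead a], the symbols scanned on the work tapes, leaves the marks untouched. *)
Definition instr_rule (q : nat) (i : instr) (a : seq nat) : rule :=
  Rule q a (inext i a) (behead a) (set_nth MStay [::] (islot i) (imove i)) (iout i).

Definition code_rules : seq rule :=
  [seq instr_rule q (nth nojump prog q.-1) a |
    q <- iota 1 (size prog), a <- all_scans K.+1].

Definition counter_machine : machine :=
  Machine K.+1 0
    (start_rule :: [seq chain_rule s | s <- iota 0 w.+1] ++ code_rules).

Let keys : seq (nat * seq nat) :=
  (0, nseq K.+2 0) :: [seq (L.+1 + s, chain_scan) | s <- iota 0 w.+1] ++
  [seq (q, a) | q <- iota 1 (size prog), a <- all_scans K.+1].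

(** The table as a function of its key. State 0 starts, the states from 1 to [size prog] carry the
    program, [L] has no rule and is where a finished program halts, and the countdown lies above
    [L]. *)
Let mk (k : nat * seq nat) : rule :=
  if k.1 is 0 then Rule 0 k.2 (L.+1 + w) (nseq K.+1 1) [:: MStay; MRight] None
  else if k.1 < L then instr_rule k.1 (nth nojump prog k.1.-1) k.2
  else let s := k.1 - L.+1 in
    Rule k.1 k.2 (if s is s'.+1 then L.+1 + s' else 1) (0 :: nseq K 1)
    (if s is 0 then [::] else [:: MStay; MRight]) None.

Let mkE : mrules counter_machine = map mk keys.
Proof.
rewrite /keys map_cons map_cat /mrules /counter_machine; congr (_ :: _ ++ _).
  rewrite -map_comp; apply: eq_map => s /=.
  by rewrite /mk /= ltnNge leqW ?leq_addr //= addKn.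
rewrite map_allpairs; congr flatten; apply/eq_in_map => q.
rewrite mem_iota add1n => /andP[q_gt0 ltq]; apply: eq_map => a.
by rewrite /mk; case: q q_gt0 ltq => //= q _ ->.
Qed.

Let mk_state k : rstate (mk k) = k.1.
Proof. by case: k => [[|q] a]; rewrite /mk //=; case: ifP. Qed.

Let mk_scan k : rscan (mk k) = k.2.
Proof. by case: k => [[|q] a]; rewrite /mk //=; case: ifP. Qed.

Definition models (q : nat) (s : state) (c : config) : Prop :=
  [/\ cstate c = q, cinput c = ihead s, cout c = outp s, size (cwork c) = K.+1 &
    forall j, j < K.+1 -> (nth (0, [::]) (cwork c) j).1 = regs s j /\
      forall i, nth 0 (nth (0, [::]) (cwork c) j).2 i = (i == 0)].

Lemma scanned_models p q s c : models q s c ->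
  scanned p c = input_cell p (ihead s) :: mkseq (fun j => regs s j == 0 : nat) K.+1.
Proof.
case=> _ hin _ sz H; rewrite /scanned hin; congr (_ :: _).
apply: (@eq_from_nth _ 0); rewrite size_map ?size_mkseq // sz => j ltj.
rewrite (nth_map (0, [::])) ?sz // nth_mkseq //.
by have [-> ->] := H j ltj.
Qed.

Lemma scanned_in p q s c : models q s c -> scanned p c \in all_scans K.+1.
Proof.
move=> /scanned_models ->.
rewrite -[X in all_scans X](size_mkseq (fun j => regs s j == 0 : nat)).
apply: mem_all_scans; first exact: input_cell_lt3.
by apply/allP => b /mapP [j _ ->]; rewrite inE; case: eqP.
Qed.

Lemma step_instr p q i s c : models q.+1 s c -> q < size prog ->
  nth nojump prog q = i ->
  exists2 c', step counter_machine p c = Some c' &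
    models (inext i (scanned p c)) (act (islot i) (imove i) (iout i) s) c'.
Proof.
move=> Hc ltq Hi; have ins := scanned_in p Hc; have sc := scanned_models p Hc.
rewrite (step_table _ _ mkE mk_state mk_scan).
have [-> hin ho sz H] := Hc.
rewrite inE mem_cat (_ : (_, _) \in [seq (q, a) | q <- _, a <- _]) ?orbT; last first.
  apply/allpairsP; exists (q.+1, scanned p c); split=> //=.
  by rewrite mem_iota add1n.
eexists; first by [].
rewrite /mk /= ltnS ltq Hi /instr_rule.
have nthm k : nth MStay (set_nth MStay [::] (islot i) (imove i)) k =
    if islot i == k then imove i else MStay.
  by rewrite nth_set_nth /= nth_nil eq_sym.
split; rewrite /= ?size_mkseq ?ho ?nthm ?hin //; first by case: eqP.
move=> j ltj.
rewrite nth_mkseq ?sz //; have [] := H j ltj.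
case E: (nth _ _ j) => [h t] /= hE tE; rewrite nthm hE; split.
  by case: eqP.
move=> x; have [_ ->] := sc; rewrite nth_set_nth /= tE (nth_map 0) ?size_iota //.
by rewrite nth_iota //; case: eqP => // ->.
Qed.

Definition embeds (l : seq instr) (q : nat) : Prop :=
  exists pre post, prog = pre ++ l ++ post /\ q = (size pre).+1.

Lemma embeds_cat l1 l2 q : embeds (l1 ++ l2) q ->
  embeds l1 q /\ embeds l2 (q + size l1).
Proof.
case=> pre [post [Hp ->]]; split.
  by exists pre, (l2 ++ post); rewrite Hp -catA.
by exists (pre ++ l1), post; rewrite -catA size_cat Hp -catA.
Qed.

Lemma step_embedded p q i l s c : embeds (i :: l) q -> models q s c ->
  exists2 c', step counter_machine p c = Some c' &
    models (inext i (scanned p c)) (act (islot i) (imove i) (iout i) s) c'.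
Proof.
move=> [pre [post [Hp ->]]] Hc; apply: (step_instr _ Hc).
  by rewrite Hp size_cat /= addnS ltnS leq_addr.
by rewrite Hp nth_cat ltnn subnn.
Qed.

Lemma test_models p t q s c : test_bound t <= K.+1 -> models q s c ->
  test_scan t (scanned p c) = holds p t s.
Proof.
move=> bt /scanned_models -> ; elim: t bt => //= [j ltj|t IH /IH -> //|t1 IH1 t2 IH2]; last first.
  by rewrite geq_max => /andP[/IH1 -> /IH2 ->].
by rewrite (nth_map 0) ?size_iota // nth_iota //; case: (regs s j).
Qed.

Lemma act_stay s : act 0 MStay None s = s.
Proof. by case: s. Qed.

Lemma step_jump p q f l s c : embeds (jump f :: l) q -> models q s c ->
  exists2 c', step counter_machine p c = Some c' & models (f (scanned p c)) s c'.
Proof. by move=> He /(step_embedded p He) [c' ?]; rewrite act_stay; exists c'. Qed.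

Lemma reach1 M p c c' : step M p c = Some c' -> reach M p 1 c c'.
Proof. by []. Qed.

(** The induction is on the execution, since another round of a loop runs the very same
    instructions. *)
Lemma compileP p c s s' : exec p c s s' -> cmd_bound c <= K.+1 ->
  forall q, embeds (compile c q) q -> forall cf, models q s cf ->
  exists n cf', reach counter_machine p n cf cf' /\ models (q + csize c) s' cf'.
Proof.
elim=> {c s s'} [k d o s|c1 c2 s s1 s2 _ IH1 _ IH2|t c s s1 s2 ht _ IH1 _ IH2|t c s ht] /=.
- move=> _ q He cf /(step_embedded p He) [cf' st Hc].
  by exists 1, cf'; rewrite addn1; split=> //; exact: reach1.
- rewrite geq_max => /andP[/IH1 {}IH1 /IH2 {}IH2] q /embeds_cat [E1].
  rewrite size_compile => E2 cf Hc.
  have [m [cf1 [R1 {}Hc]]] := IH1 q E1 cf Hc.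
  have [n [cf2 [R2 {}Hc]]] := IH2 _ E2 cf1 Hc.
  by exists (n + m), cf2; rewrite addnA; split=> //; exact: reach_trans R1 R2.
- move=> bnd q He cf Hc; have := bnd; rewrite geq_max => /andP[bt bc].
  have [cf1 st1 Hc1] := step_jump p He Hc.
  rewrite (test_models p bt Hc) ht in Hc1.
  move: (He); rewrite -cat1s => /embeds_cat [_]; rewrite /= addn1 -cats1.
  move=> /embeds_cat [E1]; rewrite size_compile => E2.
  have [m [cf2 [R2 Hc2]]] := IH1 bc _ E1 _ Hc1.
  have [cf3 st3 Hc3] := step_jump p E2 Hc2.
  have [n [cf4 [R4 Hc4]]] := IH2 bnd _ He _ Hc3.
  exists (n + (1 + (m + 1))), cf4; split=> //.
  exact: reach_trans (reach_trans (reach_trans (reach1 st1) R2) (reach1 st3)) R4.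
- rewrite geq_max => /andP[bt bc] q He cf Hc.
  have [cf1 st1 Hc1] := step_jump p He Hc.
  rewrite (test_models p bt Hc) (negbTE ht) in Hc1.
  by exists 1, cf1; split=> //; exact: reach1.
Qed.

Definition count_state (r : nat) : state :=
  State (fun i => if i == 0 then r.+1 else 0) 0 [::].

Lemma step_start p : exists2 cf, step counter_machine p (init counter_machine) = Some cf &
  models (L.+1 + w) (count_state 0) cf.
Proof.
have sc : scanned p (init counter_machine) = nseq K.+2 0.
  by rewrite /scanned /= map_nseq.
rewrite (step_table _ _ mkE mk_state mk_scan) sc inE eqxx.
eexists; first by [].
split=> // [|j ltj]; first by rewrite /= size_map size_iota size_nseq.
rewrite /apply_rule [cwork _]/cwork nth_mkseq ?size_nseq // nth_nseq ltj.
case: j ltj => [|j] ltj; first by split=> // -[|i] //=; rewrite nth_nil.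
rewrite ltnS in ltj; split=> [|i]; first by rewrite /= nth_nil.
by rewrite /= nth_nseq ltj; case: i => //= i; rewrite nth_nil.
Qed.

Lemma step_chain p s r cf : s <= w -> models (L.+1 + s) (count_state r) cf ->
  exists2 cf', step counter_machine p cf = Some cf' &
    if s is s'.+1 then models (L.+1 + s') (count_state r.+1) cf'
    else models 1 (count_state r) cf'.
Proof.
move=> les Hc; have : scanned p cf = chain_scan.
  rewrite (scanned_models p Hc) /mkseq /=; congr [:: _, _ & _].
  apply: (@eq_from_nth _ 0); rewrite !size_map ?size_nseq size_iota // => i lti.
  by rewrite (nth_map 0) ?size_iota // nth_nseq nth_iota // lti.
rewrite (step_table _ _ mkE mk_state mk_scan) => sc; rewrite sc.
have [-> hin ho sz H] := Hc.
rewrite inE mem_cat (_ : (_, _) \in [seq _ | _ <- iota 0 _]) ?orbT; last first.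
  by apply/mapP; exists s => //; rewrite mem_iota.
eexists; first by [].
rewrite /mk /= ltnNge leqW ?leq_addr //= addKn.
suff tapes d : d = (if s is 0 then MStay else MRight) ->
    models (if s is s'.+1 then L.+1 + s' else 1)
      (count_state (if s is 0 then r else r.+1)) (apply_rule
  (Rule (L.+1 + s) chain_scan (if s is s'.+1 then L.+1 + s' else 1) (0 :: nseq K 1)
    (if s is 0 then [::] else [:: MStay; MRight]) None) cf).
  by have := tapes _ erefl; case: (s).
move=> dE.
have mv j : nth MStay (if s is 0 then [::] else [:: MStay; MRight]) j =
  if j == 1 then d else MStay by rewrite dE; case: (s) => [|s1]; case: j => [|[|[]]].
split; rewrite /= ?size_mkseq ?ho ?mv ?hin // => j ltj.
rewrite nth_mkseq ?sz // mv; have [] := H j ltj.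
case: (nth _ _ j) => [h t] /= -> tE; split.
  by case: j {ltj} => //=; rewrite dE; clear; case: (s).
move=> i; rewrite nth_set_nth /= tE; case: j ltj => [|j] ltj /=; first by case: eqP => // ->.
by rewrite nth_nseq -ltnS ltj; case: eqP => // ->.
Qed.

Lemma start_models p : exists n cf,
  reach counter_machine p n (init counter_machine) cf /\ models 1 (count_state w) cf.
Proof.
have [cf0 st0 Hc0] := step_start p.
suff [n [cf [R Hc]]] : exists n cf, reach counter_machine p n cf0 cf /\
    models 1 (count_state w) cf.
  by exists (n + 1), cf; split=> //; exact: reach_trans (reach1 st0) R.
have : forall s r cf, s + r = w -> models (L.+1 + s) (count_state r) cf ->
    exists n cf', reach counter_machine p n cf cf' /\ models 1 (count_state w) cf'.
  elim=> [|s IH] r cf wE /(step_chain p) [|cf1 st1 Hc1].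
  - by [].
  - by exists 1, cf1; split; [exact: reach1 | rewrite -wE].
  - by rewrite -wE leq_addr.
  - have [|n [cf2 [R2 Hc2]]] := IH _ _ _ Hc1; first by rewrite addnS.
    by exists (n + 1), cf2; split=> //; exact: reach_trans (reach1 st1) R2.
by move=> /(_ w 0 cf0); apply; rewrite ?addn0.
Qed.

Lemma exit_halts p s cf : models L s cf -> step counter_machine p cf = None.
Proof.
move=> Hc; rewrite (step_table _ _ mkE mk_state mk_scan).
have [-> _ _ _ _] := Hc.
rewrite inE mem_cat; case: ifP => // /or3P[/eqP [//]|/mapP|/allpairsP].
  by move=> [s' _ [/eqP]]; rewrite ltn_eqF // ltnS leq_addr.
move=> [[q a] [/=]]; rewrite mem_iota add1n => /andP[_ ltq] _ [qE _].
by move: ltq; rewrite -qE ltnn.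
Qed.
End Machine.

(** * Machines with one unbounded loop *)

Section Loop.
Variables (K w : nat) (pre body : cmd) (t : test).
Let c := Seq pre (While t body).
Hypothesis bound_c : cmd_bound c <= K.+1.

Definition loop_machine := counter_machine K w (compile c 1).

Let q := 1 + csize pre.

Let code_embeds : embeds (compile c 1) (compile c 1) 1.
Proof. by exists [::], [::]; rewrite cats0. Qed.

Let while_embeds : embeds (compile c 1) (compile (While t body) q) q.
Proof. by have /embeds_cat[_] := code_embeds; rewrite size_compile. Qed.

Let bound_pre : cmd_bound pre <= K.+1.
Proof. by move: bound_c; rewrite geq_max => /andP[]. Qed.

Let bound_test : test_bound t <= K.+1.
Proof. by move: bound_c; rewrite !geq_max => /and3P[]. Qed.

Let bound_body : cmd_bound body <= K.+1.
Proof. by move: bound_c; rewrite !geq_max => /and3P[]. Qed.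

Lemma loop_enter p s : exec p pre (count_state w) s ->
  exists n cf, reach loop_machine p n (init loop_machine) cf /\ models K q s cf.
Proof.
move=> Hpre; have [n [cf [R Hc]]] := start_models K w (compile c 1) p.
have /embeds_cat[E _] := code_embeds.
have [m [cf' [R' Hc']]] := compileP w Hpre bound_pre E Hc.
by exists (m + n), cf'; split=> //; exact: reach_trans R R'.
Qed.

(** The [n.+1] records that a round takes at least one step; an unending loop thus yields runs of
    every length. *)
Lemma loop_round p s s' cf : models K q s cf -> holds p t s -> exec p body s s' ->
  exists n cf', reach loop_machine p n.+1 cf cf' /\ models K q s' cf'.
Proof.
move=> Hc ht Hb.
have [cf1 st1 Hc1] := step_jump w p while_embeds Hc.
rewrite (test_models p bound_test Hc) ht in Hc1.
have [i wE] : exists i, compile (While t body) q =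
    [:: i] ++ (compile body q.+1 ++ [:: jump (fun=> q)]).
  by eexists; rewrite cats1.
have := while_embeds; rewrite wE => /embeds_cat[_]; rewrite [size _]/= addn1.
move=> /embeds_cat[E1]; rewrite size_compile => E2.
have [m [cf2 [R2 Hc2]]] := compileP w Hb bound_body E1 Hc1.
have [cf3 st3 Hc3] := step_jump w p E2 Hc2.
exists (m + 1), cf3; split=> //; rewrite -add1n.
exact: reach_trans (reach_trans (reach1 st1) R2) (reach1 st3).
Qed.

Lemma loop_exit p s cf : models K q s cf -> ~~ holds p t s ->
  exists2 cf', step loop_machine p cf = Some cf' & step loop_machine p cf' = None.
Proof.
move=> Hc ht; have [cf1 st1 Hc1] := step_jump w p while_embeds Hc.
exists cf1 => //; apply: (exit_halts w p (s := s)).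
rewrite (test_models p bound_test Hc) (negbTE ht) in Hc1.
by rewrite size_compile -add1n addnA.
Qed.

Lemma run_add (M : machine) p m n cf :
  run M p m = Some cf -> run M p (n + m) = iter n (obind (step M p)) (Some cf).
Proof. by rewrite /run iterD => ->. Qed.

Lemma run_none (M : machine) p m n : m <= n -> run M p m = None -> run M p n = None.
Proof.
move=> /subnK <-; rewrite /run iterD => ->.
by elim: (n - m) => //= d ->.
Qed.

Variables (p : baire) (I : nat -> state -> Prop) (b : nat -> bool).
Hypothesis I0 : exists s, exec p pre (count_state w) s /\ I 0 s.
Hypothesis Ib : forall n s, I n s -> holds p t s = b n.
Hypothesis IS : forall n s, I n s -> b n -> exists s', exec p body s s' /\ I n.+1 s'.

Lemma loop_reach n : (forall i, i < n -> b i) ->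
  exists tm cf s, [/\ n <= tm, run loop_machine p tm = Some cf, models K q s cf & I n s].
Proof.
elim: n => [_|n IH bn].
  have [s [Hs I0s]] := I0; have [m [cf [R Hc]]] := loop_enter Hs.
  by exists m, cf, s.
have [i ltin|tm [cf [s [letm R Hc In]]]] := IH; first exact/bn/ltnW.
have [s' [Hb In']] := IS In (bn n (ltnSn n)).
have [|m [cf' [R' Hc']]] := loop_round Hc _ Hb; first by rewrite (Ib In) bn.
exists (m.+1 + tm), cf', s'; split=> //; first by rewrite addSn ltnS (leq_trans letm) ?leq_addl.
by rewrite (run_add _ R).
Qed.

Lemma loop_halts : halts loop_machine p <-> exists n, ~~ b n.
Proof.
split=> [[tm H]|exb].
  apply: contrapT => nb.
  have [i _|tm' [cf [s [le R _ _]]]] := @loop_reach tm.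
    by apply: contrapT => /negP bi; apply: nb; exists i.
  by rewrite (run_none le H) in R.
case: (ex_minnP exb) => n nbn minn.
have [i lti|tm [cf [s [_ R Hc In]]]] := @loop_reach n.
  by apply: contraTT lti => /minn; rewrite leqNgt.
have [|cf' st st'] := loop_exit (p := p) Hc; first by rewrite (Ib In).
(* One step leaves the loop, the next finds no rule. *)
by exists (2 + tm); rewrite (run_add _ R) /= st /= st'.
Qed.
End Loop.

(** * Total correctness of counter programs *)

Definition wp (p : baire) (c : cmd) (Q : state -> Prop) (s : state) : Prop :=
  exists s', exec p c s s' /\ Q s'.

Section Wp.
Variable p : baire.

Lemma wp_act k d o (Q : state -> Prop) s : Q (act k d o s) -> wp p (Act k d o) Q s.
Proof. by move=> HQ; exists (act k d o s); split=> //; exact: exec_act. Qed.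

Lemma wp_seq c1 c2 (Q : state -> Prop) s :
  wp p c1 (wp p c2 Q) s -> wp p (Seq c1 c2) Q s.
Proof.
by move=> [s1 [H1 [s2 [H2 HQ]]]]; exists s2; split=> //; exact: exec_seq H1 H2.
Qed.

Lemma wp_mono c (Q Q' : state -> Prop) s :
  (forall s, Q s -> Q' s) -> wp p c Q s -> wp p c Q' s.
Proof. by move=> QQ' [s' [H /QQ']]; exists s'. Qed.

Lemma wp_exit t c (Q : state -> Prop) s : ~~ holds p t s -> Q s -> wp p (While t c) Q s.
Proof. by move=> ht HQ; exists s; split=> //; exact: exec_exit. Qed.

Lemma wp_loop t c (Q : state -> Prop) s :
  holds p t s -> wp p c (wp p (While t c) Q) s -> wp p (While t c) Q s.
Proof.
by move=> ht [s1 [H1 [s2 [H2 HQ]]]]; exists s2; split=> //; exact: exec_loop H1 H2.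
Qed.

(** The index counts the rounds still to come and thereby proves termination. *)
Lemma wp_while t c (I : nat -> state -> Prop) n s :
  (forall s, I 0 s -> ~~ holds p t s) ->
  (forall i s, i < n -> I i.+1 s -> holds p t s /\ wp p c (I i) s) ->
  I n s -> wp p (While t c) (I 0) s.
Proof.
move=> I0; elim: n s => [|n IH] s IS In; first by apply: wp_exit => //; exact: I0.
have [ht Hc] := IS n s (ltnSn n) In.
apply: wp_loop => //; apply: wp_mono Hc => s' In'.
by apply: IH In' => i s1 lti; apply: IS; exact: ltnW.
Qed.
End Wp.

(** The registers hold the stack [l ++ t] followed by zeros. *)
Definition stack (l t : seq nat) (o : seq bool) (s : state) : Prop :=
  regs s =1 nth 0 (l ++ t) /\ outp s = o.

Definition inc k := Act k.+1 MRight None.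
Definition dec k := Act k.+1 MLeft None.
Definition skip := Act 0 MStay None.
Definition for_ k c := While (TNot (TZero k)) (Seq (dec k) c).
Definition move_ i j := for_ i (inc j).
(** Register [f] is a flag, zero before and after. *)
Definition ifnz k f c1 c2 :=
  Seq (inc f) (Seq (While (TAnd (TNot (TZero k)) (TNot (TZero f))) (Seq (dec f) c1))
                   (for_ f c2)).

Lemma nth_set (t : seq nat) k x i :
  nth 0 (set_nth 0 t k x) i = if i == k then x else nth 0 t i.
Proof. exact: nth_set_nth. Qed.

Section Stack.
Variable p : baire.
Implicit Types (l t : seq nat) (o : seq bool).

(** Addresses relative to [size l] make [l] a frame that commands acting on [t] preserve. *)
Lemma stack_act l t o s k d : stack l t o s ->
  stack l (set_nth 0 t k (shift d (nth 0 t k))) o (act (size l + k).+1 d None s).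
Proof.
move=> [rE oE]; split=> // i; rewrite /= !rE !nth_cat nth_set.
rewrite eqSS; case: ltnP => [lti|/subnK <-].
  by rewrite gtn_eqF // ltn_addr.
by rewrite addnK addnC eqn_add2r eq_sym; case: eqP => // ->.
Qed.

Lemma wp_inc l t o k s (Q : state -> Prop) : stack l t o s ->
  (forall s', stack l (set_nth 0 t k (nth 0 t k).+1) o s' -> Q s') ->
  wp p (inc (size l + k)) Q s.
Proof. by move=> Hs HQ; apply/wp_act/HQ/(stack_act k MRight). Qed.

Lemma wp_dec l t o k s (Q : state -> Prop) : stack l t o s ->
  (forall s', stack l (set_nth 0 t k (nth 0 t k).-1) o s' -> Q s') ->
  wp p (dec (size l + k)) Q s.
Proof. by move=> Hs HQ; apply/wp_act/HQ/(stack_act k MLeft). Qed.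

Lemma holds_zero l t o k s : stack l t o s ->
  holds p (TZero (size l + k)) s = (nth 0 t k == 0).
Proof. by move=> [rE _]; rewrite /= rE nth_cat ltnNge leq_addr /= addKn. Qed.

Lemma wp_for l k c n (I : nat -> seq nat -> Prop) (o : nat -> seq bool) s t :
  (forall i t, I i t -> nth 0 t k = i) ->
  (forall i t s, i < n -> I i.+1 t -> stack l (set_nth 0 t k i) (o i.+1) s ->
    wp p c (fun s' => exists2 t', I i t' & stack l t' (o i) s') s) ->
  I n t -> stack l t (o n) s ->
  wp p (for_ (size l + k) c) (fun s' => exists2 t', I 0 t' & stack l t' (o 0) s') s.
Proof.
move=> Ik IS In Hs.
apply: (wp_while (I := fun i s' => exists2 t', I i t' & stack l t' (o i) s') (n := n)).
- by move=> s' [t' /Ik kt' Ht']; rewrite /= negbK; have := holds_zero k Ht'; rewrite kt' /= => ->.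
- move=> i s' lti [t' It' Ht']; have kt' := Ik _ _ It'; split.
    by have := holds_zero k Ht'; rewrite kt' /= => ->.
  apply: wp_seq; apply: (wp_dec Ht') => s1; rewrite kt' /=; exact: IS.
- by exists t.
Qed.

(** Two loops act as a conditional: the flag is raised, either branch is entered only after lowering
    it, and the branch must leave it at zero. So exactly one branch runs, once. *)
Lemma wp_ifnz l t o k f c1 c2 s (Q : state -> Prop) :
  stack l t o s -> nth 0 t f = 0 -> k != f ->
  (forall s', nth 0 t k != 0 -> stack l t o s' ->
     wp p c1 (fun s'' => (exists t', nth 0 t' f = 0 /\ stack l t' o s'') /\ Q s'') s') ->
  (forall s', nth 0 t k = 0 -> stack l t o s' ->
     wp p c2 (fun s'' => (exists t', nth 0 t' f = 0 /\ stack l t' o s'') /\ Q s'') s') ->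
  wp p (ifnz (size l + k) (size l + f) c1 c2) Q s.
Proof.
move=> Hs f0 kf H1 H2; apply: wp_seq; apply: (wp_inc Hs) => s1; rewrite f0 => Hs1.
have dec1 s2 : stack l (set_nth 0 (set_nth 0 t f 1) f 0) o s2 -> stack l t o s2.
  move=> [rE oE]; split=> // i; rewrite rE !nth_cat !nth_set; case: ifP => // _.
  by case: (_ =P f) => [->|_]; rewrite ?f0.
have k1 : nth 0 (set_nth 0 t f 1) k = nth 0 t k by rewrite nth_set (negbTE kf).
have f1 : nth 0 (set_nth 0 t f 1) f = 1 by rewrite nth_set eqxx.
have hk := holds_zero k Hs1; have hf := holds_zero f Hs1.
have exit c s3 : (exists t', nth 0 t' f = 0 /\ stack l t' o s3) /\ Q s3 ->
    wp p (for_ (size l + f) c) Q s3.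
  move=> [[t' [f0' Hs2]] HQ]; apply: wp_exit => //=; rewrite negbK.
  by have := holds_zero f Hs2; rewrite f0' /= => ->.
apply: wp_seq; rewrite k1 f1 in hk hf; have [kz|knz] := eqVneq (nth 0 t k) 0.
  apply: wp_exit; first by move: hk; rewrite /= kz => ->.
  apply: wp_loop; first by move: hf; rewrite /= => ->.
  apply: wp_seq; apply: (wp_dec Hs1) => s2; rewrite f1 => /dec1 Hs2.
  by apply: wp_mono (H2 _ kz Hs2) => s3; exact: exit.
apply: wp_loop; first by move: hk hf => /= -> ->; rewrite (negbTE knz).
apply: wp_seq; apply: (wp_dec Hs1) => s2; rewrite f1 => /dec1 Hs2.
apply: wp_mono (H1 _ knz Hs2) => s3 H3; apply: wp_exit; last exact: exit.
have [[t' [f0' Hs3]] _] := H3.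
by have := holds_zero f Hs3; rewrite f0' /= => ->; rewrite andbF.
Qed.

Lemma stack_eq l t l' t' o s :
  (forall i, nth 0 (l ++ t) i = nth 0 (l' ++ t') i) -> stack l t o s -> stack l' t' o s.
Proof. by move=> e [rE oE]; split=> // i; rewrite rE. Qed.

Lemma stack_zeros l t o s n : stack l t o s <-> stack l (t ++ nseq n 0) o s.
Proof.
have e i : nth 0 (l ++ t) i = nth 0 (l ++ (t ++ nseq n 0)) i.
  rewrite catA [RHS]nth_cat; case: ltnP => // le; rewrite nth_nseq if_same.
  by rewrite nth_default.
by split; apply: stack_eq => i; rewrite e.
Qed.

Lemma wp_move l t o i j s (Q : state -> Prop) : i != j -> stack l t o s ->
  (forall s', stack l (set_nth 0 (set_nth 0 t i 0) j (nth 0 t j + nth 0 t i)) o s' -> Q s') ->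
  wp p (move_ (size l + i) (size l + j)) Q s.
Proof.
move=> ij Hs HQ; pose T m := set_nth 0 (set_nth 0 t i m) j (nth 0 t j + (nth 0 t i - m)).
(* Equality of lists is too fine here, as [set_nth] may append zeros; entries are compared
   instead. *)
pose e (t1 t2 : seq nat) := nth 0 t1 =1 nth 0 t2.
have se t1 t2 s' : e t1 t2 -> stack l t1 o s' -> stack l t2 o s'.
  by move=> e12; apply: stack_eq => k; rewrite !nth_cat e12.
apply: (@wp_mono p _ (fun s' => exists2 t', e t' (T 0) & stack l t' o s')).
  by move=> s' [t' e' /(se _ _ _ e')]; rewrite /T subn0; exact: HQ.
apply: (@wp_for l i _ (nth 0 t i) (fun m t' => e t' (T m)) (fun=> o) s t) => //.
- by move=> m t' ->; rewrite /T !nth_set (negbTE ij) eqxx.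
- move=> m t' s' ltm e' Hs'; apply: (wp_inc Hs') => s'' Hs''.
  exists (T m) => //; apply: se Hs'' => k; rewrite /T !nth_set.
  rewrite [j == i]eq_sym (negbTE ij) !e' /T !nth_set !eqxx.
  case: (eqVneq k j) => [_|kj]; first by rewrite -addnS subnSK.
  by case: (eqVneq k i) => // ki.
- move=> k; rewrite /T subnn addn0 !nth_set.
  by case: (eqVneq k j) => [->//|_]; case: (eqVneq k i) => [->|].
Qed.
End Stack.
Arguments wp_inc {p l t o k s Q} _ _.
Arguments wp_dec {p l t o k s Q} _ _.
Arguments wp_ifnz {p l t o k f c1 c2 s Q} _ _ _ _ _.
Arguments wp_move {p l t o i j s Q} _ _ _.

(** * Counter programs for primitive recursive functionals *)

Local Notation "c1 ;; c2" := (Seq c1 c2) (at level 61, right associativity).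

Definition clear_ i := for_ i skip.
Definition split_ i j k := for_ i (inc j;; inc k).
Definition dup r := split_ (r + 0) (r + 1) (r + 2);; move_ (r + 2) (r + 0).
Definition swap r :=
  move_ (r + 1) (r + 2);; move_ (r + 0) (r + 1);; move_ (r + 2) (r + 0).
(** From [x] and [y] in the first two registers, register [r + 2] starts at [y] and collects the sum
    of the numbers up to [x + y], which is Cantor's formula. *)
Definition pair_cmd r :=
  split_ (r + 1) (r + 0) (r + 2);;
  for_ (r + 0) (inc (r + 2);; split_ (r + 0) (r + 2) (r + 3);; move_ (r + 3) (r + 0));;
  move_ (r + 2) (r + 0).
(** Takes as many steps along the diagonals from [(0, 0)] as register [r] says, just as [cunpair]
    recurses; register [r + 3] is the flag of the conditional. *)
Definition unpair_cmd r :=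
  for_ (r + 0) (ifnz (r + 1) (r + 3) (dec (r + 1);; inc (r + 2))
                                     (move_ (r + 2) (r + 1);; inc (r + 1)));;
  move_ (r + 1) (r + 0);; move_ (r + 2) (r + 1).

Definition in_left := Act 0 MLeft None.
Definition in_right := Act 0 MRight None.
(** The head returns to the left marker because an earlier query may have left it anywhere. Symbol 2
    is the bit 1, so a run of 2s is a block; register [r] counts down the blocks to skip and then
    counts up the length of the next one. *)
Definition oracle_cmd r :=
  While (TNot (TInput (pred1 0))) in_left;; in_right;;
  for_ (r + 0) (While (TInput (pred1 2)) in_right;; in_right);;
  While (TInput (pred1 2)) (in_right;; inc (r + 0)).

(** The argument and the value are in register [r]; the registers above [r] are zero
    before and after. *)
Fixpoint pr_cmd (f : pr) (r : nat) : cmd :=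
  match f with
  | PId => skip
  | PZero => clear_ (r + 0)
  | PSucc => inc (r + 0)
  | PFst => unpair_cmd r;; clear_ (r + 1)
  | PSnd => unpair_cmd r;; clear_ (r + 0);; move_ (r + 1) (r + 0)
  | POracle => oracle_cmd r
  | PComp f g => pr_cmd g r;; pr_cmd f r
  | PPair f g =>
      dup r;; pr_cmd g (r + 1);; swap r;; pr_cmd f (r + 1);; swap r;; pair_cmd r
  | PIter f =>
      unpair_cmd r;; swap r;; for_ (r + 0) (pr_cmd f (r + 1));; move_ (r + 1) (r + 0)
  end.

Section PrCmd.
Variable p : baire.
Implicit Types (l t : seq nat) (o : seq bool).

Lemma wp_skip (Q : state -> Prop) s : Q s -> wp p skip Q s.
Proof. by move=> HQ; apply: wp_act; rewrite act_stay. Qed.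

Lemma stack_nth l t t' o s :
  nth 0 t =1 nth 0 t' -> stack l t o s -> stack l t' o s.
Proof. by move=> e; apply: stack_eq => k; rewrite !nth_cat e. Qed.

Lemma wp_clear l t o i s (Q : state -> Prop) : stack l t o s ->
  (forall s', stack l (set_nth 0 t i 0) o s' -> Q s') ->
  wp p (clear_ (size l + i)) Q s.
Proof.
move=> Hs HQ.
pose e m t' := nth 0 t' =1 nth 0 (set_nth 0 t i m).
apply: (@wp_mono p _ (fun s' => exists2 t', e 0 t' & stack l t' o s')).
  by move=> s' [t' e' /(stack_nth e')]; exact: HQ.
apply: (@wp_for p l i _ (nth 0 t i) e (fun=> o) s t) => //.
- by move=> m t' ->; rewrite nth_set eqxx.
- move=> m t' s' _ e' Hs'; apply: wp_skip; exists (set_nth 0 t' i m) => // k.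
  by rewrite !nth_set e' nth_set; case: eqP.
- by move=> k; rewrite nth_set; case: eqP => [->|].
Qed.

Lemma wp_split l t o i j k s (Q : state -> Prop) :
  i != j -> i != k -> j != k -> stack l t o s ->
  (forall s', stack l (set_nth 0 (set_nth 0 (set_nth 0 t i 0) j (nth 0 t j + nth 0 t i))
     k (nth 0 t k + nth 0 t i)) o s' -> Q s') ->
  wp p (split_ (size l + i) (size l + j) (size l + k)) Q s.
Proof.
move=> ij ik jk Hs HQ.
pose T m := set_nth 0 (set_nth 0 (set_nth 0 t i m) j (nth 0 t j + (nth 0 t i - m)))
  k (nth 0 t k + (nth 0 t i - m)).
pose e m t' := nth 0 t' =1 nth 0 (T m).
apply: (@wp_mono p _ (fun s' => exists2 t', e 0 t' & stack l t' o s')).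
  by move=> s' [t' e' /(stack_nth e')]; rewrite /T subn0; exact: HQ.
apply: (@wp_for p l i _ (nth 0 t i) e (fun=> o) s t) => //.
- by move=> m t' ->; rewrite /T !nth_set (negbTE ij) (negbTE ik) eqxx.
- move=> m t' s' ltm e' Hs'; apply: wp_seq; apply: (wp_inc Hs') => s1 Hs1.
  apply: (wp_inc Hs1) => s2 Hs2.
  exists (T m) => //; apply: stack_nth Hs2 => h; rewrite /T !nth_set !e' /T !nth_set.
  rewrite [k == j]eq_sym [k == i]eq_sym [j == i]eq_sym (negbTE ij) (negbTE ik) (negbTE jk) !eqxx.
  case: (eqVneq h k) => [_|hk]; first by rewrite -addnS subnSK.
  case: (eqVneq h j) => [_|hj]; first by rewrite -addnS subnSK.
  by case: (eqVneq h i).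
- move=> h; rewrite /T subnn !addn0 !nth_set.
  case: (eqVneq h k) => [->//|_]; case: (eqVneq h j) => [->//|_].
  by case: (eqVneq h i) => [->|].
Qed.

Lemma wp_dup l x o s : stack l [:: x] o s -> wp p (dup (size l)) (stack l [:: x; x] o) s.
Proof.
move=> Hs; apply: wp_seq; apply: (wp_split _ _ _ Hs) => //= s1 Hs1.
apply: (wp_move _ Hs1) => //= s2; rewrite !add0n.
by move/(stack_zeros _ [:: x; x] _ _ 1).
Qed.

Lemma wp_swap l x y o s : stack l [:: x; y] o s -> wp p (swap (size l)) (stack l [:: y; x] o) s.
Proof.
move=> Hs; apply: wp_seq; apply: (wp_move _ Hs) => //= s1 Hs1.
apply: wp_seq; apply: (wp_move _ Hs1) => //= s2 Hs2.
apply: (wp_move _ Hs2) => //= s3; rewrite !add0n.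
by move/(stack_zeros _ [:: y; x] _ _ 1).
Qed.

(** [cpair m 0] is the triangular number of [m]; these numbers drive the loop of [pair_cmd]. *)
Lemma cpair_diag n k : cpair (n + k) 0 + k = cpair n k.
Proof. by rewrite /cpair !addn0. Qed.

Lemma cpairS_diag n : cpair n.+1 0 = cpair n 0 + n.+1.
Proof. by rewrite cpairS0 -(cpair_diag 0) add0n addnS. Qed.

Lemma wp_pair l x y o s : stack l [:: x; y] o s ->
  wp p (pair_cmd (size l)) (stack l [:: cpair x y] o) s.
Proof.
move=> Hs; apply: wp_seq; apply: (wp_split _ _ _ Hs) => //= s1; rewrite add0n => Hs1.
apply: wp_seq.
(* What has been collected plus what the remaining [i] rounds will add, the triangular number of
   [i], stays constant. *)
pose I i t := exists m, t = [:: i; 0; m; 0] /\ m + cpair i 0 = cpair x y.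
apply: (@wp_mono p _ (fun s' => exists2 t', I 0 t' & stack l t' o s')).
  move=> s2 [_ [m [-> mE]] Hs2]; apply: (wp_move _ Hs2) => //= s3; rewrite add0n.
  rewrite [cpair 0 0]/(_ + _) addn0 in mE; rewrite mE.
  by move/(stack_zeros _ [:: _] _ _ 3).
apply: (@wp_for p l 0 _ (x + y) I (fun=> o) s1 [:: x + y; 0; y; 0]).
- by move=> i t [m [-> _]].
- move=> i t s2 _ [m [-> mE]] /= Hs2.
  apply: wp_seq; apply: (wp_inc Hs2) => /= s3 Hs3.
  apply: wp_seq; apply: (wp_split _ _ _ Hs3) => //= s4 Hs4.
  apply: (wp_move _ Hs4) => //= s5; rewrite !add0n => Hs5.
  exists [:: i; 0; m.+1 + i; 0] => //; exists (m.+1 + i); split=> //.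
  by rewrite -mE cpairS_diag addSnnS -addnA [i.+1 + _]addnC.
- by exists y; rewrite [y + _]addnC cpair_diag.
- exact: (stack_zeros _ _ _ _ 1).1 Hs1.
Qed.

Lemma wp_unpair l x o s : stack l [:: x] o s ->
  wp p (unpair_cmd (size l)) (stack l [:: (cunpair x).1; (cunpair x).2] o) s.
Proof.
move=> /(stack_zeros _ _ _ _ 3) /= Hs; apply: wp_seq.
pose I i t := t = [:: i; (cunpair (x - i)).1; (cunpair (x - i)).2; 0].
apply: (@wp_mono p _ (fun s' => exists2 t', I 0 t' & stack l t' o s')).
  move=> s1 [_ ->]; rewrite subn0 => Hs1.
  apply: wp_seq; apply: (wp_move _ Hs1) => //= s2 Hs2.
  apply: (wp_move _ Hs2) => //= s3; rewrite !add0n.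
  by move/(stack_zeros _ [:: _; _] _ _ 2).
apply: (@wp_for p l 0 _ x I (fun=> o) s [:: x; 0; 0; 0]) => //.
- by move=> i t ->.
- move=> i t s1 lti -> /=; rewrite /I -(subnSK lti) /=.
  case: (cunpair (x - i.+1)) => n k /= Hs1.
  have fin t' s' : t' = [:: i; (if n is n'.+1 then (n', k.+1) else (k.+1, 0)).1;
        (if n is n'.+1 then (n', k.+1) else (k.+1, 0)).2; 0] -> stack l t' o s' ->
    (exists t', nth 0 t' 3 = 0 /\ stack l t' o s') /\ exists2 t', t' =
      [:: i; (if n is n'.+1 then (n', k.+1) else (k.+1, 0)).1;
        (if n is n'.+1 then (n', k.+1) else (k.+1, 0)).2; 0] & stack l t' o s'.
    by move=> -> Hs'; split; eexists; [split; last exact: Hs'|exact: erefl|].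
  apply: (wp_ifnz Hs1) => //= s2.
    case: n {Hs1} fin => // n fin _ Hs2.
    apply: wp_seq; apply: (wp_dec Hs2) => /= s3 Hs3.
    by apply: (wp_inc Hs3) => /= s4; exact: fin.
  move=> nE; rewrite nE /= in fin Hs1 *; move=> Hs2.
  apply: wp_seq; apply: (wp_move _ Hs2) => //= s3 Hs3.
  by apply: (wp_inc Hs3) => /= s4; rewrite add0n; exact: fin.
- by rewrite /I subnn.
Qed.

Lemma unary_bit_block n j : j <= p n -> unary_bit p (size (unary p n) + j) = (j < p n).
Proof.
move=> lej; rewrite (@unary_bitE _ n.+1) unaryS.
  rewrite nth_cat ltnNge leq_addr /= addKn nth_rcons size_nseq nth_nseq.
  by case: ltngtP lej.
by rewrite size_cat ltn_add2l size_rcons size_nseq.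
Qed.

(** The successor skips the marker in cell 0 of the input tape. *)
Let block n := (size (unary p n)).+1.

Let cell_block n j : j <= p n -> input_cell p (block n + j) = (j < p n).+1.
Proof. by move=> lej; rewrite /= unary_bit_block. Qed.

Let at_ l t o h s := stack l t o s /\ ihead s = h.

Let at_move l t o h s d : at_ l t o h s -> at_ l t o (shift d h) (act 0 d None s).
Proof. by move=> [[rE oE] hE]; split; rewrite /= ?hE. Qed.

Lemma wp_rewind l t o s : stack l t o s ->
  wp p (While (TNot (TInput (pred1 0))) in_left) (at_ l t o 0) s.
Proof.
move=> Hs; apply: (wp_while (I := at_ l t o) (n := ihead s)) => //.
  by move=> s' [_ /= ->].
move=> h s' _ Hs'; split; first by have [_ /= ->] := Hs'.
by apply: wp_act; exact: (at_move MLeft Hs').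
Qed.

Lemma wp_skip_block l t o n s : at_ l t o (block n) s ->
  wp p (While (TInput (pred1 2)) in_right;; in_right) (at_ l t o (block n.+1)) s.
Proof.
move=> Hs; apply: wp_seq.
apply: (@wp_mono p _ (at_ l t o (block n + (p n - 0)))).
  move=> s1 Hs1; apply: wp_act; have := at_move MRight Hs1.
  by rewrite /= subn0 /block unaryS size_cat size_rcons size_nseq addSn addnS.
pose I i s := i <= p n /\ at_ l t o (block n + (p n - i)) s.
apply: (@wp_mono p _ (I 0)); first by move=> s1 [].
apply: (wp_while (n := p n)).
- by move=> s1 [_ [_ hE]]; rewrite [holds _ _ _]/= hE subn0 cell_block // ltnn.
- move=> i s1 lti [_ Hs1]; split.
    have [_ hE] := Hs1; rewrite [holds _ _ _]/= hE cell_block ?leq_subr //.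
    by rewrite ltn_subrL (leq_ltn_trans _ lti).
  apply: wp_act; split; first exact: ltnW.
  by have := at_move MRight Hs1; rewrite /= -addnS subnSK.
- by split=> //; rewrite subnn addn0.
Qed.

Lemma wp_count_block l o n s : at_ l [:: 0] o (block n) s ->
  wp p (While (TInput (pred1 2)) (in_right;; inc (size l + 0))) (stack l [:: p n] o) s.
Proof.
move=> Hs; pose I i s := i <= p n /\ at_ l [:: p n - i] o (block n + (p n - i)) s.
apply: (@wp_mono p _ (I 0)); first by move=> s1 [_ []]; rewrite subn0.
apply: (wp_while (n := p n)).
- by move=> s1 [_ [_ hE]]; rewrite [holds _ _ _]/= hE subn0 cell_block // ltnn.
- move=> i s1 lti [_ Hs1]; split.
    have [_ hE] := Hs1; rewrite [holds _ _ _]/= hE cell_block ?leq_subr //.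
    by rewrite ltn_subrL (leq_ltn_trans _ lti).
  apply: wp_seq; apply: wp_act.
  have [Hs2 hE2] := at_move MRight Hs1.
  apply: wp_act; split; first exact: ltnW.
  have := stack_act 0 MRight Hs2; rewrite [shift _ _]/= subnSK // => Hs3; split=> //.
  by move: hE2; rewrite /= -addnS subnSK.
- by split=> //; rewrite subnn addn0.
Qed.

Lemma wp_oracle l x o s : stack l [:: x] o s ->
  wp p (oracle_cmd (size l)) (stack l [:: p x] o) s.
Proof.
move=> Hs; apply: wp_seq; apply: wp_mono (wp_rewind Hs) => s1 Hs1.
apply: wp_seq; apply: wp_act; have {Hs1} := at_move MRight Hs1.
rewrite [shift _ _]/= -[1]/(block 0); move: (act _ _ _ _) => s2 Hs2.
apply: wp_seq; apply: (@wp_mono p _ (at_ l [:: 0] o (block (x - 0)))).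
  by move=> s3; rewrite subn0; exact: wp_count_block.
apply: (wp_while (I := fun i => at_ l [:: i] o (block (x - i))) (n := x)).
- by move=> s3 [Hs3 _]; rewrite [holds _ _ _]/= negbK; exact: (holds_zero p 0 Hs3).
- move=> i s3 lti [Hs3 hE]; split.
    by rewrite [holds _ _ _]/=; have /= -> := holds_zero p 0 Hs3.
  apply: wp_seq; apply: wp_act; rewrite -(subnSK lti); apply: wp_skip_block.
  by split; [exact: (stack_act 0 MLeft Hs3) | rewrite /= hE].
- by rewrite subnn.
Qed.

(** The lower part [l] is arbitrary so that the induction can push a saved value onto it and run the
    subprogram one register higher. *)
Lemma pr_cmdP f l x o s : stack l [:: x] o s ->
  wp p (pr_cmd f (size l)) (stack l [:: pr_eval p f x] o) s.
Proof.
have push l1 t' y s' : stack l1 (y :: t') o s' <-> stack (l1 ++ [:: y]) t' o s'.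
  by split; apply: stack_eq => k; rewrite -catA.
have sz l1 y : size l1 + 1 = size (l1 ++ [:: y]) by rewrite size_cat.
elim: f l x s => [|||||| f IHf g IHg | f IHf g IHg | f IHf] l x s Hs /=.
- exact: wp_skip.
- by apply: (wp_clear Hs).
- by apply: (wp_inc Hs).
- apply: wp_seq; apply: wp_mono (wp_unpair Hs) => s1 Hs1.
  by apply: (wp_clear Hs1) => s2 /(stack_zeros _ [:: _] _ _ 1).
- apply: wp_seq; apply: wp_mono (wp_unpair Hs) => s1 Hs1.
  apply: wp_seq; apply: (wp_clear Hs1) => s2 Hs2.
  by apply: (wp_move _ Hs2) => //= s3; rewrite add0n => /(stack_zeros _ [:: _] _ _ 1).
- exact: wp_oracle.
- by apply: wp_seq; apply: wp_mono (IHg _ _ _ Hs) => s1; exact: IHf.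
- apply: wp_seq; apply: wp_mono (wp_dup Hs) => s1 /push Hs1.
  apply: wp_seq; rewrite (sz _ x); apply: wp_mono (IHg _ _ _ Hs1) => s2 /(push _ _ _ _).2 Hs2.
  apply: wp_seq; apply: wp_mono (wp_swap Hs2) => s3 /push Hs3.
  rewrite -(sz _ x) (sz _ (pr_eval p g x)).
  apply: wp_seq; apply: wp_mono (IHf _ _ _ Hs3) => s4 /(push _ _ _ _).2 Hs4.
  by apply: wp_seq; apply: wp_mono (wp_swap Hs4) => s5; exact: wp_pair.
- case: (cunpair x) (wp_unpair Hs) => a n /= Hu.
  apply: wp_seq; apply: wp_mono Hu => s1 Hs1.
  apply: wp_seq; apply: wp_mono (wp_swap Hs1) => s2 Hs2; apply: wp_seq.
  pose I i t := t = [:: i; iter (n - i) (pr_eval p f) a].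
  apply: (@wp_mono p _ (fun s' => exists2 t', I 0 t' & stack l t' o s')).
    move=> s3 [_ ->]; rewrite subn0 => Hs3; apply: (wp_move _ Hs3) => //= s4.
    by rewrite add0n => /(stack_zeros _ [:: _] _ _ 1).
  apply: (@wp_for p l 0 _ n I (fun=> o) s2 [:: n; a]) => //.
  + by move=> i t ->.
  + move=> i t s3 lti -> /= /push Hs3; rewrite (sz _ i).
    apply: wp_mono (IHf _ _ _ Hs3) => s4 /(push _ _ _ _).2 Hs4.
    by exists [:: i; pr_eval p f (iter (n - i.+1) (pr_eval p f) a)]; rewrite // /I -(subnSK lti).
  + by rewrite /I subnn.
Qed.
End PrCmd.
Arguments wp_clear {p l t o i s Q} _ _.

(** Value 0 means no output in this round, and [v.+1] the block for [v], so a search can feed the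
    output tape at irregular times. *)
Definition emit (y : nat) : seq bool := if y is v.+1 then rcons (nseq v true) false else [::].

Definition stream (a : nat -> nat) (n : nat) : seq bool :=
  flatten [seq emit (a i) | i <- iota 0 n].

Lemma streamS a n : stream a n.+1 = stream a n ++ emit (a n).
Proof. by rewrite /stream -[n.+1]addn1 iotaD map_cat flatten_cat /= cats0. Qed.

Definition out_cmd b := Act 0 MStay (Some b).
(** The outer loop is a conditional: the inner one empties register [k], so at most one round takes
    place. *)
Definition emit_cmd k := for_ k (for_ k (out_cmd true);; out_cmd false).

Lemma start_stack w : stack [::] [:: w.+1] [::] (count_state w).
Proof. by split=> // -[|i] //=; rewrite nth_nil. Qed.

Lemma stack_out l t o s b : stack l t o s ->
  stack l t (rcons o b) (act 0 MStay (Some b) s).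
Proof. by move=> [rE oE]; split; rewrite //= oE. Qed.

Lemma wp_emit p l t k o s :
  stack l t o s ->
  wp p (emit_cmd (size l + k)) (stack l (set_nth 0 t k 0) (o ++ emit (nth 0 t k))) s.
Proof.
move=> Hs; have := holds_zero p k Hs; case tk: (nth 0 t k) => [|v] hz.
  apply: wp_exit; first by rewrite /= negbK.
  rewrite cats0; apply: stack_nth Hs => i.
  by rewrite nth_set; case: eqP => // ->.
apply: wp_loop; first by rewrite /= in hz *; rewrite hz.
apply: wp_seq; apply: (wp_dec Hs) => s1; rewrite tk [_.-1]/= => Hs1.
pose e i t' := nth 0 t' =1 nth 0 (set_nth 0 t k i).
apply: wp_seq.
apply: (@wp_mono p _ (fun s' => exists2 t', e 0 t' & stack l t' (o ++ nseq v true) s')).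
  move=> s2 [t' e' Hs2]; apply: wp_act; have {}Hs2 := stack_nth e' (stack_out false Hs2).
  apply: wp_exit; last by rewrite [emit _]/= -rcons_cat.
  by have := holds_zero p k Hs2; rewrite nth_set eqxx /= => ->.
have -> : o ++ nseq v true = o ++ nseq (v - 0) true by rewrite subn0.
apply: (@wp_for p l k _ v e (fun i => o ++ nseq (v - i) true) s1 (set_nth 0 t k v)) => //.
- by move=> i t' ->; rewrite nth_set eqxx.
- move=> i t' s2 lti e' Hs2; apply: wp_act; exists (set_nth 0 t k i) => //.
  rewrite -(subnSK lti) -[_.+1]addn1 nseqD catA cats1; apply: stack_out.
  by apply: stack_nth Hs2 => j; rewrite !nth_set e' nth_set; case: eqP.
- by rewrite subnn cats0.
Qed.

(** Even with parameter 0 a machine starts with 1 in register 0, which must be cleared before it can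
    count rounds. *)
Definition stream_pre := pr_cmd PZero 0.
Definition stream_body a := dup 0;; pr_cmd a 1;; emit_cmd 1;; inc 0.
Definition stream_machine (a : pr) :=
  let c := stream_pre;; While (TInput predT) (stream_body a) in
  loop_machine (cmd_bound c) 0 stream_pre (stream_body a) (TInput predT).

Lemma stream_machineP a p n : exists t c, run (stream_machine a) p t = Some c /\
  cout c = stream (pr_eval p a) n.
Proof.
pose I n s := stack [::] [:: n] (stream (pr_eval p a) n) s.
have I0 : wp p stream_pre (I 0) (count_state 0).
  exact: (pr_cmdP p PZero (start_stack 0)).
have IS m s : I m s -> predT m -> wp p (stream_body a) (I m.+1) s.
  move=> Hs _; apply: wp_seq; apply: wp_mono (wp_dup p Hs) => s1 Hs1.
  apply: wp_seq; apply: wp_mono (pr_cmdP p a (l := [:: m]) Hs1) => s2 Hs2.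
  apply: wp_seq; apply: wp_mono (wp_emit p (l := [::]) (t := [:: m; _]) 1 Hs2) => s3.
  rewrite /= -streamS => Hs3.
  by apply: (wp_inc (k := 0) Hs3) => s4 /(stack_zeros _ [:: _] _ _ 1).
have Ib m s : I m s -> holds p (TInput predT) s = predT m by [].
have [//|tm [c [s [_ R [_ _ cE _ _] [_ oE]]]]] := loop_reach (leqnSn _) I0 Ib IS (n := n).
by exists tm, c; rewrite cE oE.
Qed.

(** * Machines that search, and their numbers *)

Definition search_init (h : pr) := dup 0;; pr_cmd h 1.
Definition search_pre h := pr_cmd (PPair PId PZero) 0;; search_init h.
Definition search_body h :=
  clear_ 1;; pr_cmd (PPair PFst (PComp PSucc PSnd)) 0;; search_init h.
Definition search_bound h := cmd_bound (search_pre h;; While (TZero 1) (search_body h)).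
Definition search_machine (h : pr) (w : nat) :=
  loop_machine (search_bound h) w (search_pre h) (search_body h) (TZero 1).

Lemma wp_search_init p h z s : stack [::] [:: z] [::] s ->
  wp p (search_init h) (stack [::] [:: z; pr_eval p h z] [::]) s.
Proof.
move=> Hs; apply: wp_seq; apply: wp_mono (wp_dup p Hs) => s1 Hs1.
exact: (pr_cmdP p h (l := [:: z]) Hs1).
Qed.

(** Register 0 holds [cpair w.+1 n] with the candidate [n], register 1 the verdict of [h] on it; the
    loop goes on while the verdict is zero. *)
Lemma search_machineP h w p :
  halts (search_machine h w) p <-> exists n, pr_eval p h (cpair w.+1 n) != 0.
Proof.
pose I n s := stack [::] [:: cpair w.+1 n; pr_eval p h (cpair w.+1 n)] [::] s.
apply: (@loop_halts (search_bound h) w (search_pre h) (search_body h) (TZero 1)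
  (leqnSn _) p I (fun n => pr_eval p h (cpair w.+1 n) == 0)).
- apply: wp_seq; apply: wp_mono (pr_cmdP p _ (start_stack w)) => s1.
  exact: wp_search_init.
- by move=> n s Hs; exact: (holds_zero p 1 Hs).
- move=> n s Hs /eqP hz; apply: wp_seq; apply: (wp_clear (i := 1) Hs) => s1.
  move=> /(stack_zeros _ [:: _] _ _ 1) Hs1.
  apply: wp_seq; apply: wp_mono (pr_cmdP p _ Hs1) => s2.
  by rewrite /= cpairK; exact: wp_search_init.
Qed.

Lemma prf_code_seq (G : coded) (s : baire -> G -> seq nat) :
  prf s -> prf (fun p x => code_seq (s p x)).
Proof. by move=> Hs; apply: prf_ext (prf_code Hs) _ => p x; rewrite /code /= map_id. Qed.

(** The s-m-n theorem for these machines: [w] enters the table only through the successor of state 0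
    and the list of countdown rules, while the number of tapes and the program are constants. *)
Lemma prf_counter_machine K prog :
  prf (fun _ w => code_machine (counter_machine K w prog)).
Proof.
pose L := (size prog).+1.
apply: prf_ext (_ : prf (fun _ w => cpair K.+1 (cpair 0 (code_seq
  (cpair 0 (cpair (code_seq (nseq K.+2 0)) (cpair (L.+1 + w)
     (cpair (code_seq (nseq K.+1 1)) (cpair (code_seq [:: 1; 2]) 0)))) ::
   [seq cpair (L.+1 + s) (cpair (code_seq (chain_scan K))
      (cpair (if s == 0 then 1 else L.+1 + s.-1) (cpair (code_seq (0 :: nseq K 1))
        (cpair (if s == 0 then 0 else code_seq [:: 1; 2]) 0)))) | s <- iota 0 w.+1] ++
   map code_rule (code_rules K prog)))))) _ => [|_ w].
  apply: prf_cpair; first exact: prf_const.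
  apply: prf_cpair; first exact: prf_const.
  by apply: prf_code_seq; prf.
rewrite [RHS](_ : _ = cpair K.+1 (cpair 0 (code_seq (map code_rule (start_rule K w prog ::
  [seq chain_rule K prog s | s <- iota 0 w.+1] ++ code_rules K prog))))) //.
set s1 := [seq _ | s <- iota 0 _].
have s1E : s1 = map code_rule [seq chain_rule K prog s | s <- iota 0 w.+1].
  by rewrite -map_comp; apply: eq_map => -[|s].
by rewrite map_cons map_cat -s1E.
Qed.

Lemma prf_search_machine h : prf (fun _ w => code_machine (search_machine h w)).
Proof. exact: prf_counter_machine. Qed.

(** * A primitive recursive simulation of Turing machines *)

Lemma leq_cunpair m : (cunpair m).2 <= m.
Proof. by rewrite -[X in _ <= X]cunpairK leq_cpairr. Qed.

(** Every number codes a list, so decoding costs nothing at the level of codes. *)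
Lemma decode_seqK : cancel decode_seq code_seq.
Proof.
move=> m; rewrite /decode_seq; suff H f n : n <= f -> code_seq (decode_seq_rec f n) = n.
  exact: H.
elim: f n => [|f IH] [|n] //= lenf; have := cunpairK n; have := leq_cunpair n.
by case: (cunpair n) => a b /= leb abE; rewrite IH ?abE // (leq_trans leb).
Qed.

Canonical move_coded := @Coded move code_move.
Canonical rule_coded := @Coded rule code_rule.
Canonical machine_coded := @Coded machine code_machine.
Canonical config_coded :=
  @Coded config (fun c => code (cstate c, (cinput c, (cwork c, cout c)))).

Section Structures.
Variable G : coded.

Lemma prf_decode_seq (f : baire -> G -> nat) :
  prf f -> prf (fun p x => decode_seq (f p x)).
Proof. by move=> [c Hc]; exists c => p x; rewrite Hc /code /= map_id decode_seqK. Qed.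

Lemma prf_move_nat (d : baire -> G -> move) :
  prf d -> prf (fun p x => code_move (d p x)).
Proof. by []. Qed.

Lemma prf_decode_move (f : baire -> G -> nat) :
  prf f -> prf (fun p x => decode_move (f p x)).
Proof.
move=> Hf; apply: prf_ext (_ : prf (fun p x =>
  if f p x == 0 then MLeft else if f p x == 1 then MStay else MRight)) _ => [|p x].
  by prf.
by case: (f p x) => [|[|]].
Qed.

Lemma prf_decode_out (f : baire -> G -> nat) :
  prf f -> prf (fun p x => decode_out (f p x)).
Proof.
move=> Hf; apply: prf_ext (_ : prf (fun p x =>
  if f p x == 0 then None else if f p x == 1 then Some false else Some true)) _ => [|p x].
  by prf.
by case: (f p x) => [|[|]].
Qed.

Lemma prf_shift (d : baire -> G -> move) (h : baire -> G -> nat) :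
  prf d -> prf h -> prf (fun p x => shift (d p x) (h p x)).
Proof.
move=> /prf_move_nat Hd Hh; apply: prf_ext (_ : prf (fun p x =>
  if code_move (d p x) == 0 then (h p x).-1
  else if code_move (d p x) == 1 then h p x else (h p x).+1)) _ => [|p x].
  by prf.
by case: (d p x).
Qed.

(** Machines must keep the numbering that [J] uses. As [code_rule] agrees with the code of this
    tuple, the fields are still reached by projections. *)
Let rule_tuple (r : rule) : nat * (seq nat * (nat * (seq nat * (seq move * option bool)))) :=
  (rstate r, (rscan r, (rnext r, (rwrite r, (rmove r, rout r))))).

Let code_tuple r : code (rule_tuple r) = code r.
Proof.
by case: r => q a q' w m o; rewrite /code /= /code_rule /= !map_id; case: o => [[]|].
Qed.

Lemma prf_tuple (f : baire -> G -> rule) : prf f -> prf (fun p x => rule_tuple (f p x)).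
Proof. by move=> [c Hc]; exists c => p x; rewrite code_tuple. Qed.

Lemma prf_rule (f : baire -> G -> rule) : prf (fun p x => rule_tuple (f p x)) -> prf f.
Proof. by move=> [c Hc]; exists c => p x; rewrite Hc code_tuple. Qed.

Variable r : baire -> G -> rule.
Hypothesis Hr : prf r.
Lemma prf_rstate : prf (fun p x => rstate (r p x)).
Proof. exact: prf_fst (prf_tuple Hr). Qed.
Lemma prf_rscan : prf (fun p x => rscan (r p x)).
Proof. exact: prf_fst (prf_snd (prf_tuple Hr)). Qed.
Lemma prf_rnext : prf (fun p x => rnext (r p x)).
Proof. exact: prf_fst (prf_snd (prf_snd (prf_tuple Hr))). Qed.
Lemma prf_rwrite : prf (fun p x => rwrite (r p x)).
Proof. exact: prf_fst (prf_snd (prf_snd (prf_snd (prf_tuple Hr)))). Qed.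
Lemma prf_rmove : prf (fun p x => rmove (r p x)).
Proof. exact: prf_fst (prf_snd (prf_snd (prf_snd (prf_snd (prf_tuple Hr))))). Qed.
Lemma prf_rout : prf (fun p x => rout (r p x)).
Proof. exact: prf_snd (prf_snd (prf_snd (prf_snd (prf_snd (prf_tuple Hr))))). Qed.

Let config_tuple (c : config) := (cstate c, (cinput c, (cwork c, cout c))).

Variable c : baire -> G -> config.
Hypothesis Hc : prf c.
Let prf_ctuple : prf (fun p x => config_tuple (c p x)).
Proof. exact: Hc. Qed.
Lemma prf_cstate : prf (fun p x => cstate (c p x)).
Proof. exact: prf_fst prf_ctuple. Qed.
Lemma prf_cinput : prf (fun p x => cinput (c p x)).
Proof. exact: prf_fst (prf_snd prf_ctuple). Qed.
Lemma prf_cwork : prf (fun p x => cwork (c p x)).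
Proof. exact: prf_fst (prf_snd (prf_snd prf_ctuple)). Qed.
Lemma prf_cout : prf (fun p x => cout (c p x)).
Proof. exact: prf_snd (prf_snd (prf_snd prf_ctuple)). Qed.

Lemma prf_config q h w o : @prf G _ q -> @prf G _ h -> @prf G _ w -> @prf G _ o ->
  prf (fun p x => Config (q p x) (h p x) (w p x) (o p x)).
Proof.
move=> Hq Hh Hw Ho.
have [d Hd] := prf_pair Hq (prf_pair Hh (prf_pair Hw Ho)).
by exists d => p x; rewrite Hd.
Qed.

Let machine_tuple (M : machine) := (mtapes M, (mstart M, mrules M)).

Variable M : baire -> G -> machine.
Hypothesis HM : prf M.
Let prf_mtuple : prf (fun p x => machine_tuple (M p x)).
Proof. exact: HM. Qed.
Lemma prf_mtapes : prf (fun p x => mtapes (M p x)).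
Proof. exact: prf_fst prf_mtuple. Qed.
Lemma prf_mstart : prf (fun p x => mstart (M p x)).
Proof. exact: prf_fst (prf_snd prf_mtuple). Qed.
Lemma prf_mrules : prf (fun p x => mrules (M p x)).
Proof. exact: prf_snd (prf_snd prf_mtuple). Qed.
End Structures.

Ltac prf_struct := idtac; lazymatch goal with
  | |- prf (fun p x => decode_seq _) => apply: prf_decode_seq
  | |- prf (fun p x => decode_move _) => apply: prf_decode_move
  | |- prf (fun p x => decode_out _) => apply: prf_decode_out
  | |- prf (fun p x => shift _ _) => apply: prf_shift
  | |- prf (fun p x => rstate _) => apply: prf_rstate
  | |- prf (fun p x => rscan _) => apply: prf_rscan
  | |- prf (fun p x => rnext _) => apply: prf_rnext
  | |- prf (fun p x => rwrite _) => apply: prf_rwrite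
  | |- prf (fun p x => rmove _) => apply: prf_rmove
  | |- prf (fun p x => rout _) => apply: prf_rout
  | |- prf (fun p x => cstate _) => apply: prf_cstate
  | |- prf (fun p x => cinput _) => apply: prf_cinput
  | |- prf (fun p x => cwork _) => apply: prf_cwork
  | |- prf (fun p x => cout _) => apply: prf_cout
  | |- prf (fun p x => Config _ _ _ _) => apply: prf_config
  | |- prf (fun p x => mtapes _) => apply: prf_mtapes
  | |- prf (fun p x => mstart _) => apply: prf_mstart
  | |- prf (fun p x => mrules _) => apply: prf_mrules
  | |- _ => prf_more
  end.

(** Together with the simulation this gives a step-bounded universal machine: the index may be an
    argument, as approximating [J] requires. *)
Lemma prf_decode_machine (G : coded) (f : baire -> G -> nat) :
  prf f -> prf (fun p x => decode_machine (f p x)).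
Proof.
move=> Hf.
have Hrule : prf (fun (_ : baire) n => decode_rule n).
  apply: prf_rule; apply: prf_ext (_ : prf (fun _ n =>
    let n1 := (cunpair n).2 in let n2 := (cunpair n1).2 in
    let n3 := (cunpair n2).2 in let n4 := (cunpair n3).2 in
    ((cunpair n).1, (decode_seq (cunpair n1).1, ((cunpair n2).1,
     (decode_seq (cunpair n3).1,
       (map decode_move (decode_seq (cunpair n4).1), decode_out (cunpair n4).2))))))) _.
    by cbv zeta; prf_with prf_struct.
  move=> _ n; rewrite /decode_rule; case: (cunpair n) => ? n1 /=.
  case: (cunpair n1) => ? n2 /=; case: (cunpair n2) => ? n3 /=.
  by case: (cunpair n3) => ? n4 /=; case: (cunpair n4).
have [c Hc] : prf (fun p x => ((cunpair (f p x)).1, ((cunpair (cunpair (f p x)).2).1,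
   map decode_rule (decode_seq (cunpair (cunpair (f p x)).2).2)))).
  apply: prf_pair; first by prf.
  apply: prf_pair; first by prf.
  apply: prf_map; last by prf_with prf_struct.
  by apply: (prf_comp (F := fun _ n => decode_rule n)) => //; prf.
exists c => p x; rewrite Hc /decode_machine.
by case: (cunpair (f p x)) => k n /=; case: (cunpair n).
Qed.

Lemma prf_apply_rule (G : coded) (r : baire -> G -> rule) (c : baire -> G -> config) :
  prf r -> prf c -> prf (fun p x => apply_rule (r p x) (c p x)).
Proof.
move=> Hr Hc; apply: prf_ext (_ : prf (fun p x =>
  Config (rnext (r p x)) (shift (nth MStay (rmove (r p x)) 0) (cinput (c p x)))
    (mkseq (fun j => let t := nth (0, [::]) (cwork (c p x)) j in
       (shift (nth MStay (rmove (r p x)) j.+1) t.1,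
        set_nth 0 t.2 t.1 (nth 0 (rwrite (r p x)) j)))
      (size (cwork (c p x))))
    (if rout (r p x) is Some b then cout (c p x) ++ [:: b] else cout (c p x)))) _.
  by cbv zeta; prf_with prf_struct.
move=> p x; rewrite /apply_rule; congr Config; last by case: rout => // b; rewrite cats1.
by apply: eq_map => j; case: (nth (0, [::]) _ _).
Qed.

(** At least the first [n.+1] cells of the input tape. *)
Definition tape (p : baire) (n : nat) : seq nat :=
  0 :: [seq (nat_of_bool b).+1 | b <- unary p n].

Definition sim_scanned (w : seq nat) (c : config) : seq nat :=
  nth 0 w (cinput c) :: [seq nth 0 t.2 t.1 | t <- cwork c].

Definition sim_step (M : machine) (w : seq nat) (c : config) : option config :=
  if [seq r <- mrules M | (rstate r == cstate c) && (rscan r == sim_scanned w c)] is r :: _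
  then Some (apply_rule r c) else None.

(** A halted machine keeps its configuration, which makes the simulation total in [t]; [conf] does
    the same for true runs. *)
Definition sim (M : machine) (w : seq nat) (t : nat) : config :=
  iter t (fun c => odflt c (sim_step M w c)) (init M).

Definition sim_halted M w t : bool := ~~ isSome (sim_step M w (sim M w t)).

Lemma prf_sim_step (G : coded) (M : baire -> G -> machine) w (c : baire -> G -> config) :
  prf M -> @prf G _ w -> prf c -> prf (fun p x => sim_step (M p x) (w p x) (c p x)).
Proof.
move=> HM Hw Hc; rewrite /sim_step /sim_scanned.
have Hs : prf (fun p x => [seq r <- mrules (M p x) | (rstate r == cstate (c p x)) &&
    (rscan r == nth 0 (w p x) (cinput (c p x)) ::
                [seq nth 0 t.2 t.1 | t <- cwork (c p x)])]).
  by prf_with prf_struct.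
apply: (prf_seqcase Hs (f := fun p x r _ => Some (apply_rule r (c p x)))).
  by apply: prf_some; apply: prf_apply_rule; prf_with prf_struct.
exact: prf_const.
Qed.

Section Simulation.
Variable G : coded.
Variables (M : baire -> G -> machine) (w : baire -> G -> seq nat) (t : baire -> G -> nat).
Hypotheses (HM : prf M) (Hw : prf w) (Ht : prf t).

Lemma prf_sim : prf (fun p x => sim (M p x) (w p x) (t p x)).
Proof.
rewrite /sim /init; apply: prf_iter => //; first by prf_with prf_struct.
apply: prf_ext (_ : prf (fun p (y : G * config) =>
    if sim_step (M p y.1) (w p y.1) y.2 is Some c then c else y.2)) _ => //.
by apply: prf_optcase; [apply: prf_sim_step | |]; prf.
Qed.

Lemma prf_sim_halted : prf (fun p x => sim_halted (M p x) (w p x) (t p x)).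
Proof.
apply: prf_ext (_ : prf (fun p x => if sim_step (M p x) (w p x)
  (sim (M p x) (w p x) (t p x)) is Some c then false else true)) _ => [|p x].
  have Hs := prf_sim; apply: prf_optcase; [exact: prf_sim_step | exact: prf_const..].
by rewrite /sim_halted; case: sim_step.
Qed.

End Simulation.

(** The simulated input [q] need not be the oracle itself: it may be an approximation to the
    jump. *)
Lemma prf_tape (G : coded) (q : baire -> G -> nat -> nat) (n : baire -> G -> nat) :
  prf (fun p (y : G * nat) => q p y.1 y.2) -> prf n ->
  prf (fun p x => tape (q p x) (n p x)).
Proof.
move=> Hq Hn; apply: prf_ext (_ : prf (fun p x =>
  0 :: [seq (nat_of_bool b).+1 | b <- foldr (fun v l => (nseq v true ++ [:: false]) ++ l)
    [::] (mkseq (q p x) (n p x))])) _ => [|p x].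
  have Hs := prf_mkseq Hq Hn.
  apply: prf_cons; first exact: prf_const.
  apply: prf_map; last by prf.
  by apply/prf_succ/prf_code; prf.
rewrite /tape /unary /mkseq; congr (_ :: map _ _).
by elim: iota => //= i s ->; rewrite cats1.
Qed.

(** Every block has at least one cell, so [n] blocks and the marker cover the cells up to [n]. *)
Lemma nth_tape p n h : h <= n -> nth 0 (tape p n) h = input_cell p h.
Proof.
case: h => //= h lth; have lt := leq_trans lth (size_unary p n).
by rewrite (nth_map false) // -unary_bitE.
Qed.

Lemma input_cell_agree p q h : (forall i, i < h -> p i = q i) ->
  input_cell p h = input_cell q h.
Proof.
case: h => //= h e; rewrite /unary_bit (_ : unary p h.+1 = unary q h.+1) //.
by congr flatten; apply/eq_in_map => i; rewrite mem_iota => /andP[_ /e ->].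
Qed.

Definition conf (M : machine) (p : baire) (t : nat) : config :=
  iter t (fun c => odflt c (step M p c)) (init M).

Lemma cinput_conf M p t : cinput (conf M p t) <= t.
Proof.
elim: t => //= t IH; rewrite /step.
case: (ohead _) => [r|] /=; last exact: leq_trans IH (leqnSn t).
by case: nth => /=; [apply: leq_trans (leq_pred _) _| |]; rewrite ?ltnS // (leq_trans IH).
Qed.

Lemma sim_stepE M p w c : nth 0 w (cinput c) = input_cell p (cinput c) ->
  sim_step M w c = step M p c.
Proof. by move=> e; rewrite /sim_step /sim_scanned e /step; case: seq.filter. Qed.

Lemma simE M p n t : t <= n -> sim M (tape p n) t = conf M p t.
Proof.
elim: t => //= t IH lttn; rewrite IH ?(ltnW lttn) // (@sim_stepE _ p) //.
by rewrite nth_tape // (leq_trans (cinput_conf M p t)) // ltnW.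
Qed.

Lemma sim_haltedP M p n :
  reflect (step M p (conf M p n) = None) (sim_halted M (tape p n) n).
Proof.
rewrite /sim_halted simE // (@sim_stepE _ p) ?nth_tape ?cinput_conf //.
by case: step => [c|] /=; constructor.
Qed.

Lemma run_conf M p t c : run M p t = Some c -> conf M p t = c.
Proof.
elim: t c => [c [<-] //|t IH c].
rewrite /run iterS -/(run M p t); case: (run M p t) IH => //= c' /(_ _ erefl) ->.
by move=> ->.
Qed.

Lemma conf_halted M p s t : s <= t -> step M p (conf M p s) = None ->
  conf M p t = conf M p s.
Proof.
by move=> /subnK <- H; elim: (t - s) => // d IH; rewrite addSn /= IH H.
Qed.

Lemma haltsP M p : halts M p <-> exists t, step M p (conf M p t) = None.
Proof.
split=> [[t]|[t H]].
  elim: t => // t IH; rewrite /run iterS -/(run M p t).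
  by case E: (run M p t) => [c|] //= H; [exists t; rewrite (run_conf E) | apply: IH].
case E: (run M p t) => [c|]; last by exists t.
by exists t.+1; rewrite /run iterS -/(run M p t) E /= -(run_conf E).
Qed.

Lemma cout_step M p c : prefix (cout c) (cout (odflt c (step M p c))).
Proof.
rewrite /step; case: (ohead _) => [r|] /=; last exact: prefix_refl.
by case: rout => [b|]; [rewrite -cats1; exact: prefix_prefix | exact: prefix_refl].
Qed.

Lemma cout_conf M p s t : s <= t -> prefix (cout (conf M p s)) (cout (conf M p t)).
Proof.
move=> /subnK <-; elim: (t - s) => [|d IH]; first exact: prefix_refl.
by rewrite addSn; apply: prefix_trans IH (cout_step _ _ _).
Qed.

(** Use principle: the cells read before time [t] are determined by the entries of the input below
    [t]. *)
Lemma conf_agree M p q t : (forall i, i < t -> p i = q i) -> conf M p t = conf M q t.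
Proof.
elim: t => //= t IH e; rewrite IH => [|i /ltnW /e //]; congr odflt.
rewrite /step /scanned (@input_cell_agree _ q) // => i lti.
exact/e/(leq_trans lti)/(leq_trans (cinput_conf _ _ _)).
Qed.

(** The state is the number of zeros read so far and the length of the [k]-th block of ones. *)
Definition read_bit (k : nat) (s : nat * nat) (b : bool) : nat * nat :=
  if b then (s.1, if s.1 == k then s.2.+1 else s.2) else (s.1.+1, s.2).

(** The first component only counts zeros, so the index 0 is arbitrary. *)
Definition blocks (l : seq bool) : nat := (foldl (read_bit 0) (0, 0) l).1.
Definition block_value (l : seq bool) (k : nat) : nat := (foldl (read_bit k) (0, 0) l).2.

Lemma prf_foldl_read (G : coded) (k : baire -> G -> nat) (l : baire -> G -> seq bool) :
  prf k -> prf l -> prf (fun p x => foldl (read_bit (k p x)) (0, 0) (l p x)).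
Proof.
move=> Hk Hl; apply: (prf_foldl (f := fun p x => read_bit (k p x))) => //.
  by rewrite /read_bit; prf.
exact: prf_const.
Qed.

Lemma foldl_read1 k l s : (foldl (read_bit k) s l).1 = s.1 + count negb l.
Proof.
elim: l s => [|b l IH] s /=; first by rewrite addn0.
by rewrite IH; case: b; rewrite //= addSnnS.
Qed.

Lemma blocksE l k : (foldl (read_bit k) (0, 0) l).1 = blocks l.
Proof. by rewrite /blocks !foldl_read1. Qed.

Lemma foldl_read2 k l s : k < s.1 -> (foldl (read_bit k) s l).2 = s.2.
Proof.
elim: l s => //= b l IH s lt; rewrite IH; case: b => //=; first by rewrite gtn_eqF.
exact: ltnW.
Qed.

(** A block below [blocks l] is closed by its zero, and later output cannot alter it. *)
Lemma block_value_prefix k l l' : prefix l l' -> k < blocks l ->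
  block_value l' k = block_value l k.
Proof.
by move=> /prefixP [s ->] lt; rewrite /block_value foldl_cat foldl_read2 // blocksE.
Qed.

Lemma leq_blocks_prefix l l' : prefix l l' -> blocks l <= blocks l'.
Proof. by move=> /prefixP [s ->]; rewrite /blocks !foldl_read1 count_cat leq_addr. Qed.

Lemma blocks_unary p n : blocks (unary p n) = n.
Proof.
rewrite /blocks foldl_read1 add0n; elim: n => // n IH.
by rewrite unaryS count_cat IH -cats1 count_cat count_nseq /= addn1.
Qed.

Lemma block_value_unary p n k : k < n -> block_value (unary p n) k = p k.
Proof.
have rep v s : foldl (read_bit k) s (nseq v true) = (s.1, if s.1 == k then v + s.2 else s.2).
  elim: v s => [|v IH] [z a] /=; first by case: eqP.
  by rewrite IH /=; case: eqP; rewrite ?addSnnS.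
have S m : block_value (unary p m.+1) k =
    (if m == k then p k else 0) + block_value (unary p m) k.
  rewrite /block_value unaryS foldl_cat -cats1 foldl_cat rep blocksE blocks_unary /=.
  by case: eqP => [->|].
have lt m : m <= k -> block_value (unary p m) k = 0.
  by elim: m => // m IH ltm; rewrite S IH ?(ltnW ltm) // ltn_eqF.
elim: n => // n IH; rewrite ltnS leq_eqVlt S => /predU1P[<-|ltk].
  by rewrite eqxx lt // addn0.
by rewrite gtn_eqF // IH.
Qed.

Lemma produces_conf M p q n : produces M p q ->
  exists t, prefix (unary q n) (cout (conf M p t)).
Proof. by move=> /(_ n) [t [c [/run_conf <- H]]]; exists t. Qed.

(** Output is never withdrawn: the present output and the first [k.+1] blocks of [q] are prefixes of
    one later output. A completed entry is thus correct at once, on which refutations rely. *)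
Lemma produces_value M p q k t : produces M p q -> k < blocks (cout (conf M p t)) ->
  block_value (cout (conf M p t)) k = q k.
Proof.
move=> Hq lt; have [t' Ht'] := produces_conf k.+1 Hq.
have := cout_conf M p (leq_maxl t t') => /block_value_prefix /(_ lt) <-.
rewrite (block_value_prefix (prefix_trans Ht' (cout_conf M p (leq_maxr t t')))).
  exact: block_value_unary.
by rewrite blocks_unary.
Qed.

(** * The two reductions *)

Section ForwardDirection.
Variable M : machine.

Definition J_approx (p : baire) (s : nat) : baire :=
  fun i => sim_halted (decode_machine i) (tape p s) s.

(** An entry changes at most once, from 0 to 1. *)
Lemma J_approx_lim p i : exists N, forall s, N <= s -> J_approx p s i = J p i.
Proof.
rewrite /J /J_approx; case: asboolP => [/haltsP [N HN]|Hn].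
  exists N => s les; have := HN; rewrite -(conf_halted les HN).
  by move=> /sim_haltedP ->.
by exists 0 => s _; case: sim_haltedP => // H; case: Hn; apply/haltsP; exists s.
Qed.

Lemma J_approx_lim_below p n :
  exists N, forall s, N <= s -> forall i, i < n -> J_approx p s i = J p i.
Proof.
elim: n => [|n [N HN]]; first by exists 0.
have [N' HN'] := J_approx_lim p n; exists (maxn N N') => s.
rewrite geq_max => /andP[/HN {}HN /HN' {}HN'] i.
by rewrite ltnS leq_eqVlt => /predU1P[->|/HN].
Qed.

(** Before convergence the simulated run may be meaningless or its output too short; [block_value]
    still returns some number, so the functional is total. *)
Definition jump_limit (p : baire) (m : nat) : nat :=
  let s := (cunpair m).1 in
  block_value (cout (sim M (tape (J_approx p s) s) s)) (cunpair m).2.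

Lemma prf_jump_limit : prf jump_limit.
Proof.
rewrite /jump_limit; apply: prf_snd; apply: prf_foldl_read; first by prf.
apply: prf_cout; apply: prf_sim; [exact: prf_const | | by prf].
apply: prf_tape; last by prf.
rewrite /J_approx; apply: prf_code; apply: prf_sim_halted; last by prf.
  by apply: prf_decode_machine; prf.
by apply: (prf_tape (q := fun p _ => p)); prf.
Qed.

Lemma jump_limitP p q : produces M (J p) q -> lim_graph (jump_limit p) q.
Proof.
move=> Hq; apply/lim_graphP => k; have [t Ht] := produces_conf k.+1 Hq.
have [N HN] := J_approx_lim_below p t.
(* From [N] on the approximation is right on the entries below [t], and [t] steps suffice to output
   entry [k]. *)
exists (maxn N t) => s; rewrite geq_max => /andP[/HN agree les].
rewrite /jump_limit cpairK simE // (block_value_prefix _ (l := unary q k.+1)).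
- exact: block_value_unary.
- apply: prefix_trans (cout_conf _ _ les).
  by rewrite (conf_agree _ agree).
- by rewrite blocks_unary.
Qed.

Lemma jump_limit_functional p y y' : y = jump_limit p -> y' = jump_limit p -> y = y'.
Proof. by move=> -> ->. Qed.

Lemma jump_limit_computable : computable (PFun jump_limit_functional).
Proof.
(* The successor makes [emit] write a block in every round. *)
have [c Hc] : prf (fun p n => (jump_limit p n).+1) by apply/prf_succ/prf_jump_limit.
exists (stream_machine c) => p q /= -> n.
have [t [cf [R E]]] := stream_machineP c p n.
exists t, cf; split=> //; rewrite E (_ : stream _ n = unary (jump_limit p) n) ?prefix_refl //.
by congr flatten; apply: eq_map => i; rewrite Hc.
Qed.
End ForwardDirection.

Section BackwardDirection.
Variable M : machine.

(** [z] codes [((k, (N, v)).+1, (n, t))], where the successor matches the initial register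
    of [search_machine]: by time [t] the machine has output an entry [(n, k)]
    that differs from [v], although [N <= n]. *)
Definition refutes (p : baire) (z : nat) : bool :=
  let kNv := cunpair (cunpair z).1.-1 in let Nv := cunpair kNv.2 in
  let nt := cunpair (cunpair z).2 in
  let l := cout (sim M (tape p nt.2) nt.2) in let i := cpair nt.1 kNv.1 in
  (Nv.1 <= nt.1) && ((i < blocks l) && ~~ (block_value l i == Nv.2)).

Lemma prf_refutes : prf refutes.
Proof.
rewrite /refutes; cbv zeta.
have Hl : prf (fun p z =>
  cout (sim M (tape p (cunpair (cunpair z).2).2) (cunpair (cunpair z).2).2)).
  apply: prf_cout; apply: prf_sim; [exact: prf_const | | by prf].
  by apply: (prf_tape (q := fun p _ => p)); prf.
apply: prf_and; first by prf.
apply: prf_and.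
  apply: prf_leq; first by prf.
  by apply: prf_fst; apply: prf_foldl_read; prf.
apply: prf_not; apply: prf_eqn; last by prf.
by apply: prf_snd; apply: prf_foldl_read; prf.
Qed.

(** A violation found is genuine because completed entries are correct; a genuine one is found once
    its entry has been output. *)
Lemma refutesP p y k N v : produces M p y ->
  (exists nt, refutes p (cpair (cpair k (cpair N v)).+1 nt)) <->
  ~ (forall n, N <= n -> y (cpair n k) = v).
Proof.
move=> Hy; split=> [[nt]|H].
  rewrite /refutes !(cpairK, succnK) /= simE // => /and3P[leN lt /eqP neq] /(_ _ leN) E.
  by apply: neq; rewrite (produces_value Hy lt).
have [n] : exists n, ~ (N <= n -> y (cpair n k) = v) by apply/existsNP.
move=> /not_implyP [leN neq]; have [t Ht] := produces_conf (cpair n k).+1 Hy.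
have lt : cpair n k < blocks (cout (conf M p t)).
  by apply: leq_trans (leq_blocks_prefix Ht); rewrite blocks_unary.
exists (cpair n t); rewrite /refutes !(cpairK, succnK) /= simE // leN lt /=.
by rewrite (produces_value Hy lt); apply/eqP.
Qed.

Variable c : pr.
Hypothesis c_refutes : forall p z, pr_eval p c z = refutes p z.

Definition query (k m : nat) : nat := code_machine (search_machine c (cpair k m)).

Lemma J_query p y k N v : produces M p y ->
  J p (query k (cpair N v)) = 0 <-> forall n, N <= n -> y (cpair n k) = v.
Proof.
move=> Hy; rewrite /J /query code_machineK.
have E : halts (search_machine c (cpair k (cpair N v))) p <->
    ~ (forall n, N <= n -> y (cpair n k) = v).
  rewrite -(refutesP k N v Hy) search_machineP.
  by split=> -[nt H]; exists nt; move: H; rewrite c_refutes; case: refutes.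
by case: asboolP => [/E|/E /contrapT].
Qed.

(** In state [(k, m)] entry [k] of the limit is sought and [m], as the code of a pair [(N, v)], is
    on trial. The reply 0 says that the pair is never violated, and the trials start anew for the
    next entry. *)
Definition search_step (r : baire) (st : nat * nat) : nat * nat :=
  if r (query st.1 st.2) == 0 then (st.1.+1, 0) else (st.1, st.2.+1).

Definition search (r : baire) (n : nat) : nat * nat := iter n (search_step r) (0, 0).

Definition search_out (r : baire) (n : nat) : nat :=
  let st := search r n in
  if r (query st.1 st.2) == 0 then (cunpair st.2).2.+1 else 0.

Lemma prf_search_out : prf search_out.
Proof.
have Hq : prf (fun r (st : nat * nat) => query st.1 st.2).
  apply: (prf_comp (F := fun _ w => code_machine (search_machine c w))
    (f := fun _ st => cpair st.1 st.2)); [exact: prf_search_machine | by prf].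
have Hs : prf search.
  rewrite /search; apply: prf_iter; [by prf | by prf |].
  apply: (prf_comp (F := search_step) (f := fun _ x => x.2)); last by prf.
  rewrite /search_step; apply: prf_if; [|by prf..].
  by apply: prf_eq0; apply: prf_oracle.
rewrite /search_out; cbv zeta; apply: prf_if; [| by prf..].
apply: prf_eq0; apply: prf_oracle.
by apply: (prf_comp (F := fun r (st : nat * nat) => query st.1 st.2)).
Qed.

(** An accepted value is taken by all rows from some point on and so equals the limit; acceptance
    alone makes the output correct. *)
Lemma search_stream p y q n : produces M p y -> lim_graph y q ->
  stream (search_out (J p)) n = unary q (search (J p) n).1.
Proof.
move=> Hy /lim_graphP Hlim; elim: n => // n IH.
rewrite streamS IH /search iterS -/(search _ _) /search_out /search_step.
case: (search (J p) n) => k m /=; case: eqP => [Jm|_] /=; last by rewrite cats0.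
rewrite unaryS; congr (_ ++ rcons (nseq _ _) _).
rewrite -(cunpairK m) in Jm; have {}Jm := (J_query _ _ _ Hy).1 Jm.
(* A row beyond both thresholds compares the limit with the accepted value. *)
have [N HN] := Hlim k; rewrite -(HN (maxn N (cunpair m).1)) ?leq_maxl //.
by rewrite Jm // leq_maxr.
Qed.

(** Convergence provides an acceptable candidate, [cpair N (q k)], so the search for each entry
    ends, at the least accepted [m]. *)
Lemma search_reaches p y q k : produces M p y -> lim_graph y q ->
  exists n, search (J p) n = (k, 0).
Proof.
move=> Hy /lim_graphP Hlim; elim: k => [|k [n0 IH]]; first by exists 0.
have ex : exists m, J p (query k m) == 0.
  have [N HN] := Hlim k; exists (cpair N (q k)); apply/eqP.
  by apply/(J_query _ _ _ Hy).
case: (ex_minnP ex) => m Jm minm; exists (m.+1 + n0).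
suff H i : i <= m -> search (J p) (i + n0) = (k, i).
  by rewrite addSn /search iterS -/(search _ _) H // /search_step /= Jm.
elim: i => // i IHi lti; rewrite addSn /search iterS -/(search _ _) IHi ?(ltnW lti) //.
rewrite /search_step /=; case: ifP => // /minm; by rewrite leqNgt lti.
Qed.

Lemma search_computable p y q (d : pr) : (forall r n, pr_eval r d n = search_out r n) ->
  produces M p y -> lim_graph y q -> produces (stream_machine d) (J p) q.
Proof.
move=> Hd Hy Hq k; have [n Hn] := search_reaches k Hy Hq.
have [t [cf [R E]]] := stream_machineP d (J p) n.
exists t, cf; split=> //; rewrite E (_ : stream _ n = stream (search_out (J p)) n).
  by rewrite (search_stream n Hy Hq) Hn prefix_refl.
by congr flatten; apply: eq_map => i; rewrite Hd.
Qed.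
End BackwardDirection.

Local Open Scope classical_set_scope.

Theorem corollary4p24 (U : Type) (X Y : represented_space U)
    (XY : carrier X `<=` carrier Y) :
  reducible (jump_space X) Y <-> reducible X (limit_space Y).
Proof.
split=> [[F [M HM] HF]|[G [M HM] HG]].
  exists (PFun (@jump_limit_functional M)); first exact: jump_limit_computable.
  move=> p x px; have [|q Fq Yq] := HF (J p) x; first by exists p.
  by exists (jump_limit M p) => //; exists q => //; exact/jump_limitP/HM.
(* Its domain consists of the [J p] for which [G p] is defined and has a limit, so the machine has
   to be correct only there. *)
pose F := Defs.pcomp (Defs.pcomp Defs.lim G) (Defs.pinv J_inj).
have [c Hc] := prf_refutes M; have [d Hd] := prf_search_out c.
exists F.
  exists (stream_machine d) => _ q [p <- [y Gy yq]].
  exact: (search_computable Hc Hd (HM _ _ Gy)).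
move=> _ x [p <- px]; have [y Gy [q yq Yq]] := HG _ _ px.
by exists q => //; exists p => //; exists y.
Qed.
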